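(* Let $\mu\in(0,1)$ and let $\epsilon>0$, with $H(L_1)+\epsilon\le H(L_2)$, be such that for every $d\in(H(L_1),H(L_1)+\epsilon)$ the Moser-regularized hypersurface $\overline\Sigma_d^{\mathfrak M}$ admits a contact form whose Reeb flow corresponds to a reparametrization of the Hamiltonian flow of the restricted three-body problem (such an $\epsilon$ exists by a theorem of Albers, Frauenfelder, van Koert and Paternain). Then for every $d\in(H(L_1),H(L_1)+\epsilon)$ the Birkhoff-regularized energy hypersurface $\overline\Sigma_d^{\mathfrak B}$ admits a contact form whose Reeb flow corresponds to a reparametrization of the Hamiltonian flow of the restricted three-body problem.
   Context: Restricted three-body problem. For $\mu\in(0,1)$ let $q^E=(1-\mu,0)$ (Earth), $q^M=(-\mu,0)$ (Moon), and $$H:T^*(\mathbb{R}^2\setminus\{q^E,q^M\})\to\mathbb{R},\quad H(q,p)=\tfrac12\|p\|^2+p_1q_2-p_2q_1-\frac{\mu}{\|q-q^E\|}-\frac{1-\mu}{\|q-q^M\|},$$ with symplectic form $dp_1\wedge dq_1+dp_2\wedge dq_2$. $H$ has exactly five critical points $L_1,\dots,L_5$, ordered so that $H(L_i)\le H(L_{i+1})$. For $d\in(H(L_1),H(L_2))$, $\Sigma_d$ denotes the component of $H^{-1}(d)$ whose projection to position space is bounded; it surrounds both primaries. Moser regularization. Let $\mathfrak{sw}(q_1,q_2,p_1,p_2)=(-p_1,-p_2,q_1,q_2)$ on $T^*\mathbb{R}^2$, let $\phi:\mathbb{R}^2\to S^2$, $\phi(x)=\left(\frac{2x_1}{1+\|x\|^2},\frac{2x_2}{1+\|x\|^2},\frac{\|x\|^2-1}{1+\|x\|^2}\right)$,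 and let $\mathfrak M=T^*\phi\circ\mathfrak{sw}:T^*\mathbb{R}^2\to T^*S^2$, where $T^*\phi$ is the cotangent lift. After translating the Earth (respectively the Moon) to the origin, the closure in $T^*S^2$ of the $\mathfrak M$-image of the part of $\Sigma_d$ near that primary is a smooth hypersurface, obtained by adding a circle in the fiber $T_n^*S^2$ over the north pole $n$. Adding both circles $\Lambda_d^{\mathfrak M,E},\Lambda_d^{\mathfrak M,M}$ to $\Sigma_d$ in this way gives the closed 3-manifold $\overline\Sigma_d^{\mathfrak M}$, to which the reparametrized flow of $H$ extends. Birkhoff regularization. Shift positions so that Earth and Moon are at $\tfrac12$ and $-\tfrac12$ in $\mathbb{C}=\mathbb{R}^2$ (again writing $H$ for the shifted Hamiltonian). Let $$\mathfrak B:T^*\big(\mathbb{C}\setminus\{-\tfrac12,0,\tfrac12\}\big)\to T^*\mathbb{C},\quad \mathfrak B(z,w)=\left(\frac{z^2+\frac14}{2z},\frac{2\bar z^2w}{\bar z^2-\frac14}\right),$$ the cotangent lift of the branched double cover $z\mapsto\frac14(2z+\frac1{2z})$. The regularized Hamiltonian $K(z,w)=\mathfrak B^*\big(|q-\tfrac12||q+\tfrac12|(H(q,p)-d)\big)(z,w)$ extends smoothly to $T^*(\mathbb{C}\setminus\{0\})$. $\overline\Sigma_d^{\mathfrak B}$ is the bounded component of $K^{-1}(0)$, i.e. the one lying over $\Sigma_d$; away from the fibers over $z=\pm\frac12$ (collisions), $\mathfrak B$ restricts to a double cover onto $\Sigma_d$. ''The Reeb flow corresponds to a reparametrization of the Hamiltonian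 flow'' means that, away from the added collision fibers, the Reeb trajectories are mapped (by $\mathfrak B$, respectively by the inverse of the Moser identification) to trajectories of $H$ on $\Sigma_d$ up to time reparametrization. *)

(* Defs.v *)
From HB Require Import structures.
From mathcomp Require Import all_boot all_order all_algebra.
From mathcomp Require Import all_classical all_reals all_analysis.
From mathcomp Require Import complex.
From mathcomp Require Import ring.

Set Implicit Arguments.
Unset Strict Implicit.
Unset Printing Implicit Defensive.

Import Order.TTheory GRing.Theory Num.Theory.
Import numFieldNormedType.Exports.

Local Open Scope classical_set_scope.
Local Open Scope ring_scope.
Local Open Scope complex_scope.

(* A point of T^*R^2 (or T^*C) is a pair (position, momentum).  A point of
   T^*S^2 is a pair (xi, eta) in R^3 x R^3 with |xi| = 1 and <xi, eta> = 0,
   covectors being identified with tangent vectors by the round metric. *)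
Notation phase R := ('rV[R]_2 * 'rV[R]_2)%type.
Notation ambient_TS2 R := ('rV[R]_3 * 'rV[R]_3)%type.

Section Vectors.
Variable R : realType.

(* The norm that the library puts on 'rV[R]_n is the sup norm; [enorm] is the
   Euclidean one.  Both define the same topology and bounded sets. *)
Definition dot n (u v : 'rV[R]_n) : R := \sum_(i < n) u 0 i * v 0 i.
Definition enorm n (u : 'rV[R]_n) : R := Num.sqrt (dot u u).

Definition row2 (a b : R) : 'rV[R]_2 := \row_(i < 2) [:: a; b]`_i.
Definition row3 (a b c : R) : 'rV[R]_3 := \row_(i < 3) [:: a; b; c]`_i.
Definition basis_vec n (i : 'I_n) : 'rV[R]_n := delta_mx 0 i.

Definition to_complex (v : 'rV[R]_2) : R[i] := v 0 0 +i* v 0 1.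
Definition of_complex (z : R[i]) : 'rV[R]_2 := row2 (complex.Re z) (complex.Im z).

End Vectors.

Section Smoothness.
Variable R : realType.

(* Meant for finite-dimensional V, where it is the usual notion of C^k map. *)
Fixpoint Ck (V W : normedModType R) (k : nat) (U : set V) (f : V -> W) : Prop :=
  match k with
  | 0 => forall x, U x -> {for x, continuous f}
  | k'.+1 => (forall x, U x -> differentiable f x) /\
             (forall v, Ck k' U (fun x => 'D_v f x))
  end.

Definition smooth_on (V W : normedModType R) (U : set V) (f : V -> W) : Prop :=
  forall k, Ck k U f.

End Smoothness.

(* A space glued from pieces: the i-th piece [dom i] is identified by [chart i]
   with a subset of the normed space [amb].  It is used only when each such
   subset is an embedded 3-dimensional submanifold and the transition maps are
   diffeomorphisms, so that the glued space is a smooth 3-manifold. *)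
Record glued_space (R : realType) := GluedSpace {
  pt : Type;
  idx : Type;
  amb : normedModType R;
  dom : idx -> set pt;
  chart : idx -> pt -> amb
}.

Section ContactForms.
Variables (R : realType) (X : glued_space R).

(* Smooth local parametrizations of a 3-manifold: maps from an open subset of
   R^3 that are locally smooth immersions into one of the pieces.  By equality
   of dimensions they are local diffeomorphisms. *)
Definition parametrization (U : set 'rV[R]_3) (psi : 'rV[R]_3 -> pt X) : Prop :=
  open U /\
  forall u, U u -> exists (i : idx X) (V : set 'rV[R]_3),
    [/\ open V, V u, V `<=` U, psi @` V `<=` dom i
      & smooth_on V (chart i \o psi) /\
        forall x, V x -> injective ('d (chart i \o psi) x)].

(* A 1-form is given by its coordinate expressions: [w psi] is the pullback
   psi^* w, a 1-form on the open set of R^3 on which psi is defined, written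
   in the standard basis dx_1, dx_2, dx_3. *)
Definition coord_form :=
  ('rV[R]_3 -> pt X) -> 'rV[R]_3 -> 'rV[R]_3.

Definition one_form (w : coord_form) : Prop :=
  (forall U psi, parametrization U psi -> smooth_on U (w psi)) /\
  (forall U V psi phi (h : 'rV[R]_3 -> 'rV[R]_3),
     parametrization U psi -> parametrization V phi ->
     smooth_on U h -> h @` U `<=` V ->
     (forall u, U u -> psi u = phi (h u)) ->
     forall u v, U u -> dot (w psi u) v = dot (w phi (h u)) ('D_v h u)).

(* (d a)_u (v1, v2), for a 1-form a on an open subset of R^3 *)
Definition ext_deriv (a : 'rV[R]_3 -> 'rV[R]_3) (u v1 v2 : 'rV[R]_3) : R :=
  dot ('D_v1 a u) v2 - dot ('D_v2 a u) v1.

(* (a /\ d a)_u (v1, v2, v3) *)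
Definition wedge_ext_deriv (a : 'rV[R]_3 -> 'rV[R]_3)
    (u v1 v2 v3 : 'rV[R]_3) : R :=
  dot (a u) v1 * ext_deriv a u v2 v3 + dot (a u) v2 * ext_deriv a u v3 v1
  + dot (a u) v3 * ext_deriv a u v1 v2.

Definition contact_form (w : coord_form) : Prop :=
  one_form w /\
  forall U psi u, parametrization U psi -> U u ->
    wedge_ext_deriv (w psi) u (basis_vec R 0) (basis_vec R 1) (basis_vec R 2%:R)
      != 0.

Definition reeb_vector (a : 'rV[R]_3 -> 'rV[R]_3) (u r : 'rV[R]_3) : Prop :=
  dot (a u) r = 1 /\ forall v, ext_deriv a u r v = 0.

Definition reeb_trajectory (w : coord_form) (I : set R) (g : R -> pt X) : Prop :=
  forall t, I t ->
    exists (U : set 'rV[R]_3) (psi : 'rV[R]_3 -> pt X) (c : R -> 'rV[R]_3),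
      [/\ parametrization U psi,
          \forall s \near t, U (c s) /\ g s = psi (c s)
        & exists2 r, reeb_vector (w psi) (c t) r & is_derive t (1 : R) c r].

End ContactForms.

Section ThreeBody.
Variables (R : realType) (mu : R).

Variant primary := Earth | Moon.

Definition pos (b : primary) : 'rV[R]_2 :=
  match b with Earth => row2 (1 - mu) 0 | Moon => row2 (- mu) 0 end.

(* T^*(R^2 minus the primaries), the domain of the Hamiltonian *)
Definition phase_space : set (phase R) :=
  [set x | x.1 <> pos Earth /\ x.1 <> pos Moon].

Definition H (x : phase R) : R :=
  let q := x.1 in let p := x.2 in
  2^-1 * enorm p ^+ 2 + p 0 0 * q 0 1 - p 0 1 * q 0 0
  - mu / enorm (q - pos Earth) - (1 - mu) / enorm (q - pos Moon).

Definition critical_point (x : phase R) : Prop :=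
  phase_space x /\ forall v, 'D_v H x = 0.

Definition lagrange_points (L : 'I_5 -> phase R) : Prop :=
  [/\ injective L,
      forall x, critical_point x <-> exists i, x = L i
    & forall i j : 'I_5, (i <= j)%N -> H (L i) <= H (L j)].

(* The Hamiltonian vector field for dp_1 /\ dq_1 + dp_2 /\ dq_2, with the sign
   that gives q' = dH/dp and p' = - dH/dq. *)
Definition XH (x : phase R) : phase R :=
  (\row_(i < 2) 'D_((0, basis_vec R i) : phase R) H x,
   \row_(i < 2) - 'D_((basis_vec R i, 0) : phase R) H x).

Definition energy_level (d : R) : set (phase R) :=
  [set x | phase_space x /\ H x = d].

(* The component of H^{-1}(d) with bounded projection to position space.  It is
   unique for H(L_1) < d < H(L_2). *)
Definition Sigma (d : R) : set (phase R) :=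
  [set x | energy_level d x /\
           bounded_set (fst @` connected_component (energy_level d) x)].

Definition H_trajectory (d : R) (J : set R) (c : R -> phase R) : Prop :=
  forall s, J s -> Sigma d (c s) /\ is_derive s (1 : R) c (XH (c s)).

(* [proj] is the map to the unregularized phase space, undefined (None) on the
   added collision fibers. *)
Definition reeb_is_reparametrized_H (d : R) (X : glued_space R)
    (proj : pt X -> option (phase R)) (w : coord_form X) : Prop :=
  forall (I : set R) (g : R -> pt X),
    open I -> is_interval I -> reeb_trajectory w I g ->
    (forall t, I t -> proj (g t) <> None) ->
    exists (tau : R -> R) (c : R -> phase R),
      [/\ forall t, I t -> derivable tau t 1 /\ 0 < 'D_1 tau t,
          H_trajectory d (tau @` I) c
        & forall t, I t -> proj (g t) = Some (c (tau t))].

Definition admits_contact_form (d : R) (X : glued_space R)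
    (proj : pt X -> option (phase R)) : Prop :=
  exists w : coord_form X, contact_form w /\ reeb_is_reparametrized_H d proj w.

End ThreeBody.

Section Moser.
Variable R : realType.

Definition switch (x : phase R) : phase R := (- x.2, x.1).

Definition stereo (x : 'rV[R]_2) : 'rV[R]_3 :=
  let s := enorm x ^+ 2 in
  row3 (2 * x 0 0 / (1 + s)) (2 * x 0 1 / (1 + s)) ((s - 1) / (1 + s)).

(* T^*stereo sends (x, y) to (stereo x, eta), where eta is the vector tangent
   to the sphere at stereo x with <eta, d stereo_x v> = <y, v> for all v;
   see [cotangent_lift_tangent] and [cotangent_lift_pairing]. *)
Definition cotangent_lift (x : phase R) : ambient_TS2 R :=
  let y := x.2 in let a := dot x.1 y in let s := enorm x.1 ^+ 2 in
  (stereo x.1,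
   row3 ((1 + s) / 2 * y 0 0 - a * x.1 0 0) ((1 + s) / 2 * y 0 1 - a * x.1 0 1)
        a).

Lemma dot2E (x y : 'rV[R]_2) : dot x y = x 0 0 * y 0 0 + x 0 1 * y 0 1.
Proof.
rewrite /dot 2!big_ord_recr big_ord0 /= add0r.
by congr (x _ _ * y _ _ + x _ _ * y _ _); exact: val_inj.
Qed.

Lemma enorm2_sqr (x : 'rV[R]_2) : enorm x ^+ 2 = x 0 0 ^+ 2 + x 0 1 ^+ 2.
Proof.
by rewrite /enorm sqr_sqrtr dot2E -!expr2 // addr_ge0 // sqr_ge0.
Qed.

Lemma dot_row3 (a b c a' b' c' : R) :
  dot (row3 a b c) (row3 a' b' c') = a * a' + b * b' + c * c'.
Proof. by rewrite /dot 3!big_ord_recr big_ord0 /= add0r !mxE. Qed.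

Lemma cotangent_lift_tangent (x : phase R) :
  let c := cotangent_lift x in dot c.1 c.1 = 1 /\ dot c.1 c.2 = 0.
Proof.
case: x => x y; rewrite /cotangent_lift /stereo /= !dot_row3 enorm2_sqr dot2E.
have s0 : 1 + (x 0 0 ^+ 2 + x 0 1 ^+ 2) != 0.
  by rewrite gt_eqF // ltr_pwDl // addr_ge0 // sqr_ge0.
by split; field.
Qed.

Lemma is_derive_coord (x v : 'rV[R]_2) (i : 'I_2) :
  is_derive x v (fun y : 'rV[R]_2 => y 0 i) (v 0 i).
Proof.
have d j : derivable (fun y : 'rV[R]_2 => y 0 j) x v.
  exact/diff_derivable/differentiable_coord.
apply: DeriveDef => //.
have := derive_mx (@derivable_id R _ x v); rewrite derive_id.
by move=> /matrixP/(_ 0 i); rewrite mxE.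
Qed.

Lemma is_derive_div (f g : 'rV[R]_2 -> R) (x v : 'rV[R]_2) (df dg : R) :
  g x != 0 -> is_derive x v f df -> is_derive x v g dg ->
  is_derive x v (fun y => f y / g y) ((df * g x - f x * dg) / g x ^+ 2).
Proof.
move=> g0 [f1 f2] [g1 g2]; have gi := derivableV g0 g1.
apply: DeriveDef; first exact: derivableM.
rewrite [LHS](deriveM f1 gi) deriveV // f2 g2 /GRing.scale /=.
by field.
Qed.

Lemma cotangent_lift_pairing (x : phase R) (v : 'rV[R]_2) :
  dot (cotangent_lift x).2 ('D_v stereo x.1) = dot x.2 v.
Proof.
case: x => x y /=.
have s0 : 1 + (x 0 0 ^+ 2 + x 0 1 ^+ 2) != 0.
  by rewrite gt_eqF // ltr_pwDl // addr_ge0 // sqr_ge0.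
have c0 := is_derive_coord x v 0; have c1 := is_derive_coord x v 1.
pose s (z : 'rV[R]_2) := z 0 0 ^+ 2 + z 0 1 ^+ 2.
pose ds := 2 * (x 0 0 * v 0 0 + x 0 1 * v 0 1).
have Ds : is_derive x v s ds.
  apply: (is_derive_eq (is_deriveD (is_deriveM c0 c0) (is_deriveM c1 c1))).
  by rewrite /GRing.scale /= /ds; ring.
have D1s : is_derive x v (fun z => 1 + s z) ds.
  have h : is_derive x v (cst (1 : R) + s) (0 + ds) by exact: is_deriveD.
  by rewrite add0r in h; exact: h.
have Ds1 : is_derive x v (fun z => s z - 1) ds.
  have h : is_derive x v (s - cst (1 : R)) (ds - 0) by exact: is_deriveB.
  by rewrite subr0 in h; exact: h.
have Dc i : is_derive x v (fun z : 'rV[R]_2 => 2 * z 0 i) (2 * v 0 i).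
  exact: (is_deriveZ 2 (is_derive_coord x v i)).
have D0 := is_derive_div s0 (Dc 0) D1s.
have D1 := is_derive_div s0 (Dc 1) D1s.
have D2 := is_derive_div s0 Ds1 D1s.
have stE : stereo = fun z => row3 (2 * z 0 0 / (1 + s z)) (2 * z 0 1 / (1 + s z))
    ((s z - 1) / (1 + s z)).
  by apply/funext => z; rewrite /stereo enorm2_sqr.
have -> : 'D_v stereo x =
  row3 ((2 * v 0 0 * (1 + s x) - 2 * x 0 0 * ds) / (1 + s x) ^+ 2)
       ((2 * v 0 1 * (1 + s x) - 2 * x 0 1 * ds) / (1 + s x) ^+ 2)
       ((ds * (1 + s x) - (s x - 1) * ds) / (1 + s x) ^+ 2).
  have E k z : stereo z 0 k = [:: 2 * z 0 0 / (1 + s z); 2 * z 0 1 / (1 + s z);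
      (s z - 1) / (1 + s z)]`_k by rewrite stE mxE.
  have DE (k : 'I_3) : is_derive x v (fun z => stereo z 0 k)
     [:: (2 * v 0 0 * (1 + s x) - 2 * x 0 0 * ds) / (1 + s x) ^+ 2;
         (2 * v 0 1 * (1 + s x) - 2 * x 0 1 * ds) / (1 + s x) ^+ 2;
         (ds * (1 + s x) - (s x - 1) * ds) / (1 + s x) ^+ 2]`_k.
    under [fun z => _]funext do rewrite E.
    by case: k => -[|[|[|//]]] i /=; [exact: D0 | exact: D1 | exact: D2].
  rewrite derive_mx; last by apply/derivable_mxP => i j; rewrite ord1; case: (DE j).
  by apply/matrixP => i j; rewrite ord1 !mxE; case: (DE j).
rewrite dot_row3 enorm2_sqr !dot2E /ds /s; field.
exact: s0.
Qed.

Definition north : 'rV[R]_3 := row3 0 0 1.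

Variable mu : R.

(* the Moser map after translating the primary b to the origin *)
Definition moser (b : primary) (x : phase R) : ambient_TS2 R :=
  cotangent_lift (switch (x.1 - pos mu b, x.2)).

Definition Sigma_near (d : R) (b : primary) : set (phase R) :=
  [set x | Sigma mu d x /\ enorm (x.1 - pos mu b) < 2^-1].

(* the circle added in the fiber over the north pole *)
Definition Lambda (d : R) (b : primary) : set (ambient_TS2 R) :=
  [set y | closure (moser b @` Sigma_near d b) y /\ y.1 = north].

Variant moser_point :=
  | Regular of phase R
  | Collision of primary & ambient_TS2 R.

(* One piece for each primary b: Sigma_d together with the circle of b, sitting
   in T^*S^2 by the Moser map.  All of Sigma_d is used, not only its part near
   b, since the Moser map is a diffeomorphism onto T^*(S^2 minus the pole). *)
Definition moser_dom (d : R) (b : primary) : set moser_point :=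
  [set g | match g with
           | Regular x => Sigma mu d x
           | Collision b' y => b' = b /\ Lambda d b y
           end].

Definition moser_chart (b : primary) (g : moser_point) : ambient_TS2 R :=
  match g with Regular x => moser b x | Collision _ y => y end.

Definition moser_space (d : R) : glued_space R :=
  {| pt := moser_point; idx := primary; amb := ambient_TS2 R;
     dom := moser_dom d; chart := moser_chart |}.

Definition moser_proj (g : moser_point) : option (phase R) :=
  match g with Regular x => Some x | Collision _ _ => None end.

Definition moser_admits_contact_form (d : R) : Prop :=
  admits_contact_form mu d (X := moser_space d) moser_proj.

End Moser.

Section Birkhoff.
Variable R : realType.

(* Earth and Moon in shifted coordinates *)
Definition shifted_pos (b : primary) : 'rV[R]_2 :=
  match b with Earth => row2 2^-1 0 | Moon => row2 (- 2^-1) 0 end.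

Definition birkhoff (x : phase R) : phase R :=
  let z := to_complex x.1 in let w := to_complex x.2 in
  (of_complex ((z ^+ 2 + 4^-1) / (2 * z)),
   of_complex (2 * z^* ^+ 2 * w / (z^* ^+ 2 - 4^-1))).

(* T^*(C minus {-1/2, 0, 1/2}) *)
Definition birkhoff_domain : set (phase R) :=
  [set x | [/\ x.1 <> 0, x.1 <> shifted_pos Earth & x.1 <> shifted_pos Moon]].

Variable mu : R.

(* from shifted coordinates back to the original ones *)
Definition unshift (x : phase R) : phase R := (x.1 + row2 (2^-1 - mu) 0, x.2).

Definition H_shifted (x : phase R) : R := H mu (unshift x).

Definition K_raw (d : R) (x : phase R) : R :=
  let y := birkhoff x in
  enorm (y.1 - shifted_pos Earth) * enorm (y.1 - shifted_pos Moon)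
  * (H_shifted y - d).

(* The extension of K_raw by continuity to T^*(C minus {0}); it equals K_raw on
   birkhoff_domain. *)
Definition K (d : R) (x : phase R) : R :=
  lim (K_raw d y @[y --> within birkhoff_domain (nbhs x)]).

Definition K_level (d : R) : set (phase R) := [set x | x.1 <> 0 /\ K d x = 0].

(* The bounded component of K^{-1}(0), the one lying over Sigma_d. *)
Definition SigmaB (d : R) : set (phase R) :=
  [set x | K_level d x /\
     let C := connected_component (K_level d) x in
     bounded_set C /\
     (unshift \o birkhoff) @` (C `&` birkhoff_domain) `<=` Sigma mu d].

Definition birkhoff_space (d : R) : glued_space R :=
  {| pt := phase R; idx := unit; amb := phase R;
     dom := fun _ => SigmaB d; chart := fun _ x => x |}.

Definition birkhoff_proj (x : phase R) : option (phase R) :=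
  if x \in birkhoff_domain then Some (unshift (birkhoff x)) else None.

Definition birkhoff_admits_contact_form (d : R) : Prop :=
  admits_contact_form mu d (X := birkhoff_space d) birkhoff_proj.

End Birkhoff.

(* Main.v *)
(* The composition of the Birkhoff map with the Moser map at a primary, a priori
   defined away from the collisions, extends over the collision fiber z = +-1/2
   by an explicit rational formula, and the extension is an immersion where
   w <> 0.  As K is nonzero at (+-1/2, 0), it restricts to a local diffeomorphism
   (in fact a double cover) from the Birkhoff hypersurface to the Moser one.  The
   contact form on the Birkhoff side is the pullback of the given one: Reeb
   trajectories are mapped to Reeb trajectories, and away from collisions both
   hypersurfaces carry the same projection to Sigma_d. *)
From HB Require Import structures.
Require Import Defs.
From mathcomp Require Import all_boot all_order all_algebra.
From mathcomp Require Import all_classical all_reals all_analysis.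
From mathcomp Require Import complex ring.

Set Implicit Arguments.
Unset Strict Implicit.
Unset Printing Implicit Defensive.

Import Order.TTheory GRing.Theory Num.Theory.
Import numFieldNormedType.Exports.

Local Open Scope classical_set_scope.
Local Open Scope complex_scope.
Local Open Scope ring_scope.

(** * Smooth maps *)

Section SmoothMaps.
Variables (R : realType) (V : normedModType R).

(** A 1-form is recorded as one coordinate expression per parametrization, so pulling back along
    [lift_to_moser] is mere precomposition. Everything thus reduces to one claim: if [psi]
    parametrizes the Birkhoff hypersurface, then [lift_to_moser \o psi] parametrizes the Moser
    space. The extended Moser map at one primary has a pole over the other one. The claim is local,
    so a suitable primary is chosen near each point. Collision points belong to the Moser space only
    as limits of regular ones, and [K] is itself a limit there. Both difficulties are met by a
    dimension count: an immersed piece of R^3 cannot stay inside a collision fiber, so its regular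
    parameters are dense. The immersion property is not read off a Jacobian. Denominator-free
    identities are differentiated instead; the decisive one is the inverse of the Moser map, which
    recovers the position [zeta^2 / 2z] and remains informative up to the collision, where
    [alpha <> 0] takes over. *)

Lemma near_eq_differentiable (W : normedModType R) (f g : V -> W) (x : V) :
  (\near x, f x = g x) -> differentiable f x -> differentiable g x.
Proof.
move=> fg df; have fgx : f x = g x by apply: nbhs_singleton fg.
have E : g \o shift x = cst (g x) + 'd f x +o_ 0 id.
  apply/eqaddoP => e e0; have /eqaddoP/(_ e e0) := diff_locally df.
  have : \forall h \near (0 : V), f (h + x) = g (h + x).
    have := @cvgD _ _ _ (nbhs (0 : V)) _ id (cst x) 0 x cvg_id (cvg_cst _).
    by rewrite add0r => /(_ _ _ _ fg); apply.
  apply: filterS2 => h.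
  move=> fgh; rewrite -[X in _ -> `|X| <= _]/(g (h + x) - (g x + 'd f x h)).
  by rewrite -fgh -fgx.
have dg := diff_unique (@diff_continuous _ _ _ _ _ df) E.
apply/(@diff_locallyP _ _ _ x g); rewrite dg; split; last exact: E.
exact: diff_continuous.

Qed.

(** The derivative of a product or an inverse again contains the undifferentiated function, so those
    inductions on [k] need it at the lower order too. *)
Lemma CkW (W : normedModType R) k (U : set V) (f : V -> W) :
  Ck k.+1 U f -> Ck k U f.
Proof.
elim: k f => [f [df _] x Ux|k ih f [df Df]].
  exact/differentiable_continuous/df.
by split=> // v; apply/ih/Df.
Qed.

Lemma Ck_sub (W : normedModType R) k (U U' : set V) (f : V -> W) :
  U' `<=` U -> Ck k U f -> Ck k U' f.
Proof.
move=> sU; elim: k f => [f h x /sU|k ih f [df Df]]; first exact: h.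
by split=> [x /sU|v]; [exact: df|exact/ih/Df].
Qed.

Variables (U : set V) (oU : open U).

Lemma open_near_eq (T : Type) (f g : V -> T) x :
  (forall y, U y -> f y = g y) -> U x -> \near x, f x = g x.
Proof. by move=> fg Ux; apply: filterS (open_nbhs_nbhs (conj oU Ux)). Qed.

Lemma Ck_eq (W : normedModType R) k (f g : V -> W) :
  (forall x, U x -> f x = g x) -> Ck k U f -> Ck k U g.
Proof.
elim: k f g => [f g fg cf x Ux|k ih f g fg [df Df]].
  rewrite /prop_for /continuous_at -(fg x Ux); apply: cvg_trans (cf x Ux).
  by apply: near_eq_cvg; apply: open_near_eq.
split=> [x Ux|v]; first exact: near_eq_differentiable (open_near_eq fg Ux) (df x Ux).
apply: ih (Df v) => x Ux; exact: near_eq_derive (open_near_eq fg Ux).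
Qed.

Lemma Ck_cst (W : normedModType R) k (a : W) : Ck k U (cst a).
Proof.
elim: k a => [a x _|k ih a]; first exact: cvg_cst.
split=> [x _|v]; first exact: differentiable_cst.
by rewrite [fun x => _](_ : _ = cst 0); last by apply/funext => x; rewrite derive_cst.
Qed.

Lemma CkD (W : normedModType R) k (f g : V -> W) :
  Ck k U f -> Ck k U g -> Ck k U (fun x => f x + g x).
Proof.
elim: k f g => [f g cf cg x Ux|k ih f g [df Df] [dg Dg]].
  by apply: cvgD; [exact: cf|exact: cg].
split=> [x Ux|v]; first by apply: differentiableD; [exact: df|exact: dg].
apply: Ck_eq (ih _ _ (Df v) (Dg v)) => x Ux.
by rewrite -deriveD; [|exact/diff_derivable/df|exact/diff_derivable/dg].
Qed.

Lemma derive_linear (W W' : normedModType R) (L : W -> W') (f : V -> W) x v :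
  linear L -> continuous L -> differentiable f x ->
  differentiable (L \o f) x /\ 'D_v (L \o f) x = L ('D_v f x).
Proof.
move=> linL cL df.
pose LM := GRing.isLinear.Build _ _ _ _ _ linL.
pose LL : {linear W -> W'} := HB.pack L LM.
have dL : differentiable L (f x) by exact: (@linear_differentiable _ _ _ LL).
have dLf : differentiable (L \o f) x by exact: differentiable_comp.
split=> //; rewrite !deriveE// diff_comp//=.
by rewrite (@diff_lin _ _ _ LL).
Qed.

Lemma Ck_linear (W W' : normedModType R) k (L : W -> W') (f : V -> W) :
  linear L -> continuous L -> Ck k U f -> Ck k U (L \o f).
Proof.
move=> linL cL; elim: k f => [f cf x Ux|k ih f [df Df]].
  by apply: continuous_comp; [exact: cf|exact: cL].
split=> [x Ux|v]; first by case: (derive_linear 0 linL cL (df x Ux)).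
by apply: Ck_eq (ih _ (Df v)) => x Ux; case: (derive_linear v linL cL (df x Ux)).
Qed.

Lemma CkM k (f g : V -> R) :
  Ck k U f -> Ck k U g -> Ck k U (fun x => f x * g x).
Proof.
elim: k f g => [f g cf cg x Ux|k ih f g hf hg].
  by apply: cvgM; [exact: cf|exact: cg].
case: (hf) => df Df; case: (hg) => dg Dg.
split=> [x Ux|v]; first by apply: differentiableM; [exact: df|exact: dg].
apply: Ck_eq (CkD (ih _ _ (CkW hf) (Dg v)) (ih _ _ (CkW hg) (Df v))) => x Ux.
by rewrite -deriveM; [|exact/diff_derivable/df|exact/diff_derivable/dg].
Qed.

Lemma CkV k (f : V -> R) :
  (forall x, U x -> f x != 0) -> Ck k U f -> Ck k U (fun x => (f x)^-1).
Proof.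
move=> f0; elim: k f f0 => [f f0 cf x Ux|k ih f f0 hf].
  by apply: cvgV; [exact: f0|exact: cf].
case: (hf) => df Df; split=> [x Ux|v].
  by apply: differentiableV; [exact: df|exact: f0].
have hV := ih _ f0 (CkW hf).
apply: Ck_eq (CkM (Ck_cst k (-1 : R)) (CkM (CkM hV hV) (Df v))) => x Ux.
rewrite deriveV; [|exact: f0|exact/diff_derivable/df].
by rewrite /GRing.scale /= -invrM ?unitfE ?f0// -expr2 mulN1r mulNr.
Qed.

Lemma Ck_sum (W : normedModType R) k n (f : 'I_n -> V -> W) :
  (forall i, Ck k U (f i)) -> Ck k U (fun x => \sum_(i < n) f i x).
Proof.
elim: n f => [f _|n ih f hf].
  by apply: Ck_eq (Ck_cst k (0 : W)) => x _; rewrite big_ord0.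
apply: Ck_eq (CkD (ih _ (fun i => hf _)) (hf ord_max)) => x _.
by rewrite big_ord_recr.
Qed.

Lemma smooth_eq (W : normedModType R) (f g : V -> W) :
  (forall x, U x -> f x = g x) -> smooth_on U f -> smooth_on U g.
Proof. by move=> fg hf k; apply: Ck_eq (hf k). Qed.

Lemma smooth_id : smooth_on U (@idfun V).
Proof.
case=> [x _|k]; first exact: cvg_id.
split=> [x _|v]; first by apply: (@linear_differentiable _ _ _ idfun) => ?.
by apply: Ck_eq (Ck_cst k v) => x _; rewrite derive_id.
Qed.

Lemma smooth_row n (f : V -> 'rV[R]_n) :
  (forall i, smooth_on U (fun x => f x 0 i)) -> smooth_on U f.
Proof.
move=> hf k; have : Ck k U (fun x => \sum_(i < n) f x 0 i *: basis_vec R i).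
  apply: Ck_sum => i.
  apply: (Ck_linear (L := fun a : R => a *: basis_vec R i)) (hf i k).
    by move=> a u v; rewrite scalerDl scalerA.
  exact: scalel_continuous.
by apply: Ck_eq => x _; rewrite -row_sum_delta.
Qed.

Lemma smooth_pair (W W' : normedModType R) (f : V -> W) (g : V -> W') :
  smooth_on U f -> smooth_on U g -> smooth_on U (fun x => (f x, g x)).
Proof.
move=> hf hg k.
have lin1 : linear (fun a : W => (a, 0 : W')).
  by move=> a u v; congr pair; rewrite /= scaler0 addr0.
have lin2 : linear (fun a : W' => (0 : W, a)).
  by move=> a u v; congr pair; rewrite /= scaler0 addr0.
apply: (@Ck_eq _ _ (fun x => (f x, 0 : W') + (0 : W, g x))).
  by move=> x _; congr pair; rewrite /= ?addr0 ?add0r.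
apply: CkD; [apply: Ck_linear lin1 _ (hf k)|apply: Ck_linear lin2 _ (hg k)].
  by move=> x; apply: cvg_pair; [exact: cvg_id|exact: cvg_cst].
by move=> x; apply: cvg_pair; [exact: cvg_cst|exact: cvg_id].
Qed.

End SmoothMaps.

Section Coordinates.
Variables (R : realType) (W W' : normedModType R).

Lemma linear_fst : linear (@fst W W') /\ continuous (@fst W W').
Proof. by split=> // x; exact: cvg_fst. Qed.

Lemma linear_snd : linear (@snd W W') /\ continuous (@snd W W').
Proof. by split=> // x; exact: cvg_snd. Qed.

Lemma linear_coord n (i : 'I_n) : let c := fun v : 'rV[R]_n => v 0 i in
  linear c /\ continuous c.
Proof. by split=> [a u v|x]; [rewrite /= !mxE|exact: coord_continuous]. Qed.

End Coordinates.

(** * Complex-valued smooth functions *)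

Section ComplexValued.
Variables (R : realType) (V : normedModType R).
Implicit Types (f g : V -> R[i]) (x v : V).

(** The formulas below mix [z] with its conjugate and are not holomorphic, so differentiability is
    meant over the reals, part by part. *)
Definition smoothc (U : set V) f : Prop :=
  smooth_on U (fun x => complex.Re (f x)) /\ smooth_on U (fun x => complex.Im (f x)).

Definition is_cderive x v f (df : R[i]) : Prop :=
  is_derive x v (fun y => complex.Re (f y)) (complex.Re df) /\
  is_derive x v (fun y => complex.Im (f y)) (complex.Im df).

Lemma smoothc_sub (U U' : set V) f : U' `<=` U -> smoothc U f -> smoothc U' f.
Proof. by move=> sU [fr fi]; split=> k; apply: Ck_sub sU _. Qed.

Section Smooth.
Variables (U : set V) (oU : open U).

Lemma smoothc_eq f g : (forall x, U x -> f x = g x) -> smoothc U f -> smoothc U g.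
Proof.
by move=> fg [fr fi]; split; [move: fr|move: fi]; apply: smooth_eq => // x Ux; rewrite fg.
Qed.

Lemma smoothc_cst (c : R[i]) : smoothc U (fun=> c).
Proof. by split=> k; exact: Ck_cst. Qed.

Lemma smoothcD f g : smoothc U f -> smoothc U g -> smoothc U (fun x => f x + g x).
Proof.
move=> [fr fi] [gr gi]; split=> k.
  by apply: Ck_eq (CkD oU (fr k) (gr k)) => // x _; case: (f x) (g x) => ? ? [].
by apply: Ck_eq (CkD oU (fi k) (gi k)) => // x _; case: (f x) (g x) => ? ? [].
Qed.

Lemma smoothcM f g : smoothc U f -> smoothc U g -> smoothc U (fun x => f x * g x).
Proof.
move=> [fr fi] [gr gi]; split=> k.
  apply: Ck_eq (CkD oU (CkM oU (fr k) (gr k))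
    (CkM oU (Ck_cst U k (-1 : R)) (CkM oU (fi k) (gi k)))) => // x _.
  by case: (f x) (g x) => ? ? [? ?]; rewrite mulN1r.
by apply: Ck_eq (CkD oU (CkM oU (fr k) (gi k)) (CkM oU (fi k) (gr k))) => // x _;
  case: (f x) (g x) => ? ? [? ?].
Qed.

Lemma smoothc_conj f : smoothc U f -> smoothc U (fun x => (f x)^*).
Proof.
move=> [fr fi]; split=> k.
  by apply: Ck_eq (fr k) => // x _; case: (f x).
apply: Ck_eq (CkM oU (Ck_cst U k (-1 : R)) (fi k)) => // x _.
by case: (f x) => ? ?; rewrite mulN1r.
Qed.

Lemma smoothcN f : smoothc U f -> smoothc U (fun x => - f x).
Proof.
by move=> hf; apply: smoothc_eq (smoothcM (smoothc_cst (-1 : R[i])) hf) => x _; rewrite mulN1r.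
Qed.

Lemma smoothcV f :
  (forall x, U x -> f x != 0) -> smoothc U f -> smoothc U (fun x => (f x)^-1).
Proof.
move=> f0 [fr fi].
pose n x := complex.Re (f x) ^+ 2 + complex.Im (f x) ^+ 2.
have n0 x : U x -> n x != 0.
  move=> /f0; apply: contraNneq => /eqP; rewrite /n paddr_eq0 ?sqr_ge0//.
  by rewrite !sqrf_eq0 eq_complex.
have nV k : Ck k U (fun x => (n x)^-1).
  by apply: CkV => //; apply: Ck_eq (CkD oU (CkM oU (fr k) (fr k)) (CkM oU (fi k) (fi k))) => //.
split.
  by move=> k; apply: Ck_eq (CkM oU (fr k) (nV k)) => // x _; rewrite /n; case: (f x).
move=> k; apply: Ck_eq (CkM oU (Ck_cst U k (-1 : R)) (CkM oU (fi k) (nV k))) => // x _.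
by rewrite mulN1r /n; case: (f x).
Qed.

Lemma smoothc_is_cderive f x v : smoothc U f -> U x -> exists df, is_cderive x v f df.
Proof.
move=> [fr fi] Ux; eexists (_ +i* _).
split; apply/derivableP/diff_derivable.
  by have [+ _] := fr 1; apply.
by have [+ _] := fi 1; apply.
Qed.

End Smooth.

Lemma is_cderive_unique x v f df dg :
  is_cderive x v f df -> is_cderive x v f dg -> df = dg.
Proof.
move=> [[_ a] [_ b]] [[_ c] [_ d]].
by case: df dg a b c d => ? ? [? ?] /= <- <- <- <-.
Qed.

Lemma is_cderive_eq x v f df df' :
  is_cderive x v f df -> df = df' -> is_cderive x v f df'.
Proof. by move=> + <-. Qed.

Lemma is_cderive_cst x v (c : R[i]) : is_cderive x v (fun=> c) 0.
Proof. by split; exact: is_derive_cst. Qed.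

Lemma is_cderiveD x v f g df dg : is_cderive x v f df -> is_cderive x v g dg ->
  is_cderive x v (fun y => f y + g y) (df + dg).
Proof.
move=> [fr fi] [gr gi]; split.
  rewrite (_ : (fun _ => _) = (fun y => complex.Re (f y)) + (fun y => complex.Re (g y))).
    by apply: is_derive_eq; case: df dg {fr fi gr gi} => ? ? [].
  by apply/funext => y /=; rewrite !fctE; case: (f y) (g y) => ? ? [].
rewrite (_ : (fun _ => _) = (fun y => complex.Im (f y)) + (fun y => complex.Im (g y))).
  by apply: is_derive_eq; case: df dg {fr fi gr gi} => ? ? [].
by apply/funext => y /=; rewrite !fctE; case: (f y) (g y) => ? ? [].
Qed.

Lemma is_cderiveM x v f g df dg : is_cderive x v f df -> is_cderive x v g dg ->
  is_cderive x v (fun y => f y * g y) (f x * dg + df * g x).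
Proof.
move=> [fr fi] [gr gi]; split.
  rewrite (_ : (fun _ => _) = (fun y => complex.Re (f y)) * (fun y => complex.Re (g y)) -
                              (fun y => complex.Im (f y)) * (fun y => complex.Im (g y))).
    apply: is_derive_eq; rewrite /GRing.scale /=.
    by case: (f x) (g x) df dg {fr fi gr gi} => ? ? [? ?] [? ?] [? ?] /=; ring.
  by apply/funext => y /=; rewrite !fctE; case: (f y) (g y) => ? ? [].
rewrite (_ : (fun _ => _) = (fun y => complex.Re (f y)) * (fun y => complex.Im (g y)) +
                            (fun y => complex.Im (f y)) * (fun y => complex.Re (g y))).
  apply: is_derive_eq; rewrite /GRing.scale /=.
  by case: (f x) (g x) df dg {fr fi gr gi} => ? ? [? ?] [? ?] [? ?] /=; ring.
by apply/funext => y /=; rewrite !fctE; case: (f y) (g y) => ? ? [].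
Qed.

Lemma is_cderive_conj x v f df :
  is_cderive x v f df -> is_cderive x v (fun y => (f y)^*) df^*.
Proof.
move=> [fr fi]; split.
  rewrite (_ : (fun _ => _) = (fun y => complex.Re (f y))).
    by apply: is_derive_eq; case: df {fr fi}.
  by apply/funext => y; case: (f y).
rewrite (_ : (fun _ => _) = - (fun y => complex.Im (f y))).
  by apply: is_derive_eq; case: df {fr fi}.
by apply/funext => y /=; rewrite fctE; case: (f y).
Qed.

(** Turns an identity of functions on an open set into a linear relation between derivatives.
    Applied to identities cleared of denominators, it replaces every quotient rule. *)
Lemma is_cderive_open_unique (U : set V) x v f g df dg : open U -> U x ->
  (forall y, U y -> f y = g y) ->
  is_cderive x v f df -> is_cderive x v g dg -> df = dg.
Proof.
move=> oU Ux fg [fr fi]; apply: is_cderive_unique; split; [move: fr|move: fi];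
  by apply: near_eq_is_derive; apply: open_near_eq Ux => // y /fg ->.
Qed.

Lemma is_cderiveN x v f df :
  is_cderive x v f df -> is_cderive x v (fun y => - f y) (- df).
Proof.
move=> hf; have h := is_cderiveM (is_cderive_cst x v (-1 : R[i])) hf.
rewrite mul0r addr0 mulN1r in h.
by rewrite (_ : (fun y => _) = fun y => -1 * f y)//; apply/funext => y; rewrite mulN1r.
Qed.

End ComplexValued.

(** * The Moser map in Birkhoff coordinates *)

Section ExtendedMoserMap.
Variable R : realType.
Implicit Types (b : primary) (z w : R[i]) (x : phase R).

Definition primary_pos b : R[i] := (if b is Earth then 2^-1 else - 2^-1)%:C.

Arguments primary_pos : simpl never.

Lemma primary_pos_sqr b : primary_pos b ^+ 2 = 4^-1.
Proof.
have -> : (4^-1 : R[i]) = (4^-1)%:C by rewrite fmorphV rmorph_nat.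
by rewrite /primary_pos -rmorphXn; congr (_ %:C); case: b; field.
Qed.

Lemma primary_pos_conj b : (primary_pos b)^* = primary_pos b.
Proof. exact: conjc_real. Qed.

Lemma primary_pos_neq0 b : primary_pos b != 0.
Proof. by rewrite -sqrf_eq0 primary_pos_sqr invr_eq0 pnatr_eq0. Qed.

Lemma of_complexK : cancel (@of_complex R) (@to_complex R).
Proof. by case=> a c; rewrite /to_complex /of_complex /row2 !mxE. Qed.

Lemma to_complexK : cancel (@to_complex R) (@of_complex R).
Proof.
move=> v; apply/matrixP => i j; rewrite ord1 !mxE /to_complex.
by case: j => -[|[|//]] hj /=; congr (v _ _); exact: val_inj.
Qed.

Lemma to_complex_shifted_pos b : to_complex (shifted_pos R b) = primary_pos b.
Proof. by case: b; rewrite /to_complex !mxE. Qed.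

Lemma birkhoff_domainP x : birkhoff_domain x <->
  to_complex x.1 != 0 /\ forall b, to_complex x.1 != primary_pos b.
Proof.
have E0 : (x.1 = 0) <-> (to_complex x.1 = 0).
  split=> [->|h]; first by rewrite /to_complex !mxE.
  rewrite -(to_complexK x.1) h; apply/matrixP => i j; rewrite !mxE.
  by case: j => -[|[|//]] ?.
have Eb b : (x.1 = shifted_pos R b) <-> (to_complex x.1 = primary_pos b).
  rewrite -to_complex_shifted_pos; split=> [->//|].
  exact: (can_inj to_complexK).
split=> [[h0 hE hM]|[h0 hb]].
  by split=> [|[]]; apply/eqP; rewrite -?E0 -?Eb.
by split; rewrite ?E0 ?Eb; apply/eqP => //; exact: hb.
Qed.

(* In the Birkhoff coordinates (z, w), the position relative to the primary b is
   zeta^2 / 2z and the momentum is alpha / conj zeta.  The formulas xi, xi3, eta,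
   eta3 below are what the Moser map becomes after this substitution: the powers
   of zeta in the denominators cancel, and only (zeta, alpha) = 0 is singular.
   [xi] and [eta] collect the first two of the three real components. *)
Definition zeta b z := z - primary_pos b.
Definition alpha b z w := 2 * z^* ^+ 2 * w / (z^* + primary_pos b).
Definition nrm b z w := zeta b z * (zeta b z)^* + alpha b z w * (alpha b z w)^*.

Definition xi b z w := - (2 * alpha b z w * zeta b z) / nrm b z w.
Definition xi3 b z w :=
  (alpha b z w * (alpha b z w)^* - zeta b z * (zeta b z)^*) / nrm b z w.
Definition eta b z w :=
  zeta b z ^+ 2 / (4 * z) - alpha b z w ^+ 2 / (4 * z^*).
Definition eta3 b z w :=
  - (((alpha b z w)^* * zeta b z) / z + (alpha b z w * (zeta b z)^*) / z^*) / 4.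

(** The third coordinate is real but carried as a complex number, so that all components can be
    compared by [field] over [R[i]]. *)
Definition row_of_complex (u t : R[i]) : 'rV[R]_3 :=
  row3 (complex.Re u) (complex.Im u) (complex.Re t).

Definition moser_birkhoff b x : ambient_TS2 R :=
  let z := to_complex x.1 in let w := to_complex x.2 in
  (row_of_complex (xi b z w) (xi3 b z w), row_of_complex (eta b z w) (eta3 b z w)).

Lemma nrm_eq0 b z w : (nrm b z w == 0) = (zeta b z == 0) && (alpha b z w == 0).
Proof.
have J (u : R[i]) : (u * u^* == 0) = (u == 0) by rewrite mulf_eq0 conjC_eq0 orbb.
by rewrite /nrm paddr_eq0 ?mul_conjC_ge0// !J.
Qed.

Lemma cotangent_liftE (u v : R[i]) :
  cotangent_lift (of_complex u, of_complex v) =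
  (row_of_complex (2 * u / (1 + u * u^*)) ((u * u^* - 1) / (1 + u * u^*)),
   row_of_complex ((1 + u * u^*) / 2 * v - (u^* * v + u * v^*) / 2 * u)
     ((u^* * v + u * v^*) / 2)).
Proof.
have h : (2^-1 : R)%:C = 2^-1 by rewrite fmorphV rmorph_nat.
have h2 : (2 : R[i]) = (2 : R)%:C by rewrite rmorph_nat.
have h1 : (1 : R[i]) = (1 : R)%:C by [].
rewrite /cotangent_lift /stereo /row_of_complex dot2E enorm2_sqr /= !mxE /=.
rewrite -h h2 h1; case: u v => a c [a' c'] /=.
have n0 : 1 + (a ^+ 2 + c ^+ 2) != 0.
  by rewrite gt_eqF // ltr_pwDl // addr_ge0 // sqr_ge0.
have -> : a * - c + c * a = 0 by ring.
have -> : a * a - c * - c = a ^+ 2 + c ^+ 2 by ring.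
rewrite !addr0 expr0n addr0.
by congr pair; congr row3; field.
Qed.

Lemma pos_shifted mu b : pos mu b = row2 (2^-1 - mu) 0 + shifted_pos R b.
Proof.
apply/matrixP => i j; case: b; rewrite !mxE; case: j => -[|[|//]] ? /=;
  first [by field|by rewrite addr0].
Qed.

(** Since [1/4 = e^2] for [e = primary_pos b], the numerator [z^2 + e^2 - 2 e z] is a perfect
    square; its double zero is the branching of the cover at the primary. *)
Lemma birkhoff_pos mu b x : to_complex x.1 != 0 ->
  (unshift mu (birkhoff x)).1 - pos mu b =
  of_complex (zeta b (to_complex x.1) ^+ 2 / (2 * to_complex x.1)).
Proof.
move=> z0; rewrite pos_shifted /unshift /birkhoff /= opprD addrA addrK.
apply: (can_inj to_complexK); rewrite of_complexK -[shifted_pos _ _]to_complexK.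
rewrite to_complex_shifted_pos.
have toB (u v : R[i]) : to_complex (of_complex u - of_complex v) = u - v.
  by case: u v => ? ? [? ?]; rewrite /to_complex /= !mxE.
rewrite toB /zeta; have := primary_pos_sqr b.
by move: (primary_pos b) => e he; rewrite -he; field.
Qed.

Lemma zeta_neq0 b z : z != primary_pos b -> zeta b z != 0.
Proof. by rewrite subr_eq0. Qed.

Lemma addr_primary_pos_neq0 b z :
  (forall b', z != primary_pos b') -> z + primary_pos b != 0.
Proof.
move=> h; rewrite addr_eq0.
have -> : - primary_pos b = primary_pos (if b is Earth then Moon else Earth).
  by case: b => /=; rewrite /primary_pos -rmorphN ?opprK.
exact: h.
Qed.

(** The denominator [conj z ^ 2 - 1/4] splits as [conj zeta] times [conj z + e]. Keeping only the
    second factor in [alpha] makes it regular at [b], at the price of a pole over the other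
    primary. *)
Lemma birkhoff_mom b x : birkhoff_domain x ->
  (birkhoff x).2 = of_complex
    (alpha b (to_complex x.1) (to_complex x.2) / (zeta b (to_complex x.1))^*).
Proof.
move=> /birkhoff_domainP[z0 zb]; rewrite /birkhoff /= /alpha /zeta.
move: (to_complex x.1) (to_complex x.2) z0 zb => z w z0 zb.
have := zeta_neq0 (zb b); have := addr_primary_pos_neq0 b zb.
rewrite -conjC_eq0 rmorphD/= primary_pos_conj -(conjC_eq0 (zeta _ _)).
rewrite /zeta rmorphB/= primary_pos_conj -(primary_pos_sqr b).
move: (primary_pos b) (z^*) => e zc h1 h2; congr of_complex.
have h3 : zc ^+ 2 - e ^+ 2 != 0 by rewrite subr_sqr mulf_neq0.
by field; rewrite h1 h2 h3.
Qed.

Lemma moser_birkhoffE mu b x : birkhoff_domain x ->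
  moser mu b (unshift mu (birkhoff x)) = moser_birkhoff b x.
Proof.
move=> dx; have /birkhoff_domainP[z0 zb] := dx.
rewrite /moser birkhoff_pos// /switch -[(unshift _ _).2]/((birkhoff x).2).
rewrite (birkhoff_mom b dx) ![(_, _).1]/= ![(_, _).2]/= /moser_birkhoff.
move: (to_complex x.1) (to_complex x.2) z0 (zeta_neq0 (zb b)) => z w z0 t0.
have ofN (u : R[i]) : - of_complex u = of_complex (- u).
  apply/matrixP => i j; rewrite !mxE; case: u => u1 u2.
  by case: j => -[|[|//]].
have n0 : nrm b z w != 0 by rewrite nrm_eq0 (negPf t0).
rewrite ofN cotangent_liftE /xi /xi3 /eta /eta3; move: n0; rewrite /nrm.
move: (alpha b z w) (zeta b z) t0 => a t t0 n0.
have tc0 : t^* != 0 by rewrite conjC_eq0.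
have zc0 : z^* != 0 by rewrite conjC_eq0.
have -> : (- (a / t^*))^* = - (a^* / t) by rewrite rmorphN rmorphM fmorphV/= conjCK.
have -> : (t ^+ 2 / (2 * z))^* = t^* ^+ 2 / (2 * z^*).
  by rewrite rmorphM fmorphV rmorphXn rmorphM rmorph_nat.
(* The identity is rational in each variable and its conjugate separately, so conjugates become
   independent variables. *)
move: n0 tc0 zc0; move: (t^*) (a^*) (z^*) => tc ac zc n0 tc0 zc0.
by congr pair; congr row_of_complex; field; rewrite ?n0 ?zc0 ?z0 ?tc0 ?t0.
Qed.

(** Invariance under conjugation. Thanks to it, a derivative of the third real coordinate determines
    the complex derivative of [xi3]. *)
Lemma xi3_real b z w : complex.Im (xi3 b z w) = 0.
Proof.
have : (xi3 b z w)^* = xi3 b z w.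
  rewrite /xi3 /nrm; move: (alpha b z w) (zeta b z) => a t.
  rewrite !(rmorphM, rmorphB, rmorphD, fmorphV)/= !conjCK.
  by rewrite [a^* * a]mulrC [t^* * t]mulrC.
by case: (xi3 b z w) => u v [] /eqP; rewrite eqNr => /eqP.
Qed.

Lemma eta3_real b z w : complex.Im (eta3 b z w) = 0.
Proof.
have : (eta3 b z w)^* = eta3 b z w.
  rewrite /eta3; move: (alpha b z w) (zeta b z) => a t.
  rewrite rmorphM rmorphN rmorphD !fmorphV !(rmorphM, fmorphV)/= !conjCK rmorph_nat.
  by rewrite [a * t^* / _ + _]addrC.
by case: (eta3 b z w) => u v [] /eqP; rewrite eqNr => /eqP.
Qed.

(** The last factor inverts the cotangent lift: on the sphere [(1 - xi3) * eta + eta3 * xi] is the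
    original planar covector, which after the switch is the position [zeta^2 / 2z]. *)
Lemma position_from_moser b z w : z != 0 -> nrm b z w != 0 ->
  zeta b z ^+ 2 = 2 * z * ((1 - xi3 b z w) * eta b z w + eta3 b z w * xi b z w).
Proof.
rewrite /xi /xi3 /eta /eta3 /nrm -(conjC_eq0 z) => zc0.
have z0 : z != 0 by rewrite -conjC_eq0.
move: (alpha b z w) (zeta b z) => a t; move: (z^*) (a^*) (t^*) zc0 => zc ac tc zc0 n0.
by field; rewrite n0 zc0 z0.
Qed.

End ExtendedMoserMap.

Section PhaseCoordinates.
Variables (R : realType) (V : normedModType R) (m n : nat).
Implicit Types (f : V -> 'rV[R]_m * 'rV[R]_n).

Lemma is_derive_coord_fst f x v i : differentiable f x ->
  is_derive x v (fun y => (f y).1 0 i) (('D_v f x).1 0 i).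
Proof.
move=> df; have [l1 c1] := linear_fst 'rV[R]_m 'rV[R]_n.
have [l2 c2] := linear_coord R i.
have [d1 e1] := derive_linear v l1 c1 df.
have [d2 e2] := derive_linear v l2 c2 d1.
by apply: DeriveDef; [exact: diff_derivable d2|rewrite [LHS]e2/= e1].
Qed.

Lemma is_derive_coord_snd f x v i : differentiable f x ->
  is_derive x v (fun y => (f y).2 0 i) (('D_v f x).2 0 i).
Proof.
move=> df; have [l1 c1] := linear_snd 'rV[R]_m 'rV[R]_n.
have [l2 c2] := linear_coord R i.
have [d1 e1] := derive_linear v l1 c1 df.
have [d2 e2] := derive_linear v l2 c2 d1.
by apply: DeriveDef; [exact: diff_derivable d2|rewrite [LHS]e2/= e1].
Qed.

Lemma smooth_coord_fst (U : set V) f i : open U -> smooth_on U f ->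
  smooth_on U (fun y => (f y).1 0 i).
Proof.
move=> oU hf k; have [l1 c1] := linear_fst 'rV[R]_m 'rV[R]_n.
have [l2 c2] := linear_coord R i.
exact: (Ck_linear oU l2 c2 (Ck_linear oU l1 c1 (hf k))).
Qed.

Lemma smooth_coord_snd (U : set V) f i : open U -> smooth_on U f ->
  smooth_on U (fun y => (f y).2 0 i).
Proof.
move=> oU hf k; have [l1 c1] := linear_snd 'rV[R]_m 'rV[R]_n.
have [l2 c2] := linear_coord R i.
exact: (Ck_linear oU l2 c2 (Ck_linear oU l1 c1 (hf k))).
Qed.

End PhaseCoordinates.

(* Kernel of the differential of the extended Moser map: t, a, z, n, X, E stand
   for zeta, alpha, z, nrm, xi, eta at a point, the suffix c for conjugates and
   the prime for the derivatives. *)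
Lemma tangent_kernel (F : fieldType) (t tc a z zc e n Q X X3 E z' zc' a' n' : F) :
  2 != 0 :> F -> (t != 0 -> tc != 0) -> (t = 0 -> a != 0) -> (z' = 0 -> zc' = 0) ->
  t = z - e -> z != 0 -> z + e != 0 -> zc != 0 -> n != 0 ->
  t * t = 2 * z * Q -> X * n = - (2 * a * t) -> (1 - X3) * n = 2 * (t * tc) ->
  t * z' + z' * t = 2 * z' * Q -> X * n' = - (2 * a * z' + 2 * a' * t) ->
  (1 - X3) * n' = 2 * (t * zc' + z' * tc) ->
  4 * (z * zc' + z' * zc) * E =
    zc * (t * z' + z' * t) + zc' * (t * t) - (z * (a * a' + a' * a) + z' * (a * a)) ->
  z' = 0 /\ a' = 0.
Proof.
move=> two0 tc0 a0 zc'0 tE z0 zN zc0 n0 J2 J3 J4 E2 E3 E4 E5.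
(* At the collision [a] is nonzero: the differentiated relation for [xi] gives [a * z' = 0], and the
   one for [eta] then gives [a * a' = 0]. *)
have [t0|t0] := eqVneq t 0.
  have X0 : X = 0.
    by move/eqP: J3; rewrite t0 mulr0 oppr0 mulf_eq0 (negPf n0) orbF => /eqP.
  have z'0 : z' = 0.
    move/eqP: E3; rewrite t0 X0 mul0r mulr0 addr0 eq_sym oppr_eq0 !mulf_eq0.
    by rewrite (negPf two0) (negPf (a0 t0)) => /eqP.
  split=> //; move: E5; rewrite (zc'0 z'0) z'0 t0 !(mulr0, mul0r, addr0, add0r).
  move=> /esym/eqP; rewrite oppr_eq0 [a' * a]mulrC -mulr2n -mulr_natl !mulf_eq0.
  by rewrite (negPf two0) (negPf z0) (negPf (a0 t0)) => /eqP.
(* Off the collision, eliminating [Q] between [t^2 = 2 z Q] and its derivative leaves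
   [z' * t * (2 z - t) = 0], where [2 z - t = z + e]. *)
have z'0 : z' = 0.
  have : z' * (t * (z + e)) = 0.
    transitivity (z * (t * z' + z' * t) - z' * (t * t)); first by rewrite tE; ring.
    by rewrite E2 J2; ring.
  by move=> /eqP; rewrite !mulf_eq0 (negPf t0) (negPf zN) !orbF => /eqP.
(* As [t <> 0], also [1 - X3 <> 0]; so [n] is stationary, and the relation for [xi] reduces to
   [a' * t = 0]. *)
split=> //; have n'0 : n' = 0.
  have /eqP := E4; rewrite (zc'0 z'0) z'0 mulr0 mul0r addr0 mulr0 mulf_eq0.
  case/orP => /eqP // X30; move/eqP: J4; rewrite X30 mul0r eq_sym !mulf_eq0.
  by rewrite (negPf two0) (negPf t0) (negPf (tc0 t0)).
move/eqP: E3; rewrite n'0 z'0 !mulr0 add0r eq_sym oppr_eq0 !mulf_eq0.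
by rewrite (negPf two0) (negPf t0) orbF => /eqP.
Qed.

(** * Smoothness and immersivity of the extended Moser map *)

Section MoserBirkhoffSmooth.
Variables (R : realType) (V : normedModType R) (U : set V) (oU : open U).
Variables (psi : V -> phase R) (psi_smooth : smooth_on U psi) (b : primary).
Let z x := to_complex (psi x).1.
Let w x := to_complex (psi x).2.

Lemma smoothc_position : smoothc U z.
Proof. by split; exact: smooth_coord_fst. Qed.

Lemma smoothc_momentum : smoothc U w.
Proof. by split; exact: smooth_coord_snd. Qed.

Lemma is_cderive_phase x v : U x ->
  is_cderive x v z (to_complex ('D_v psi x).1) /\
  is_cderive x v w (to_complex ('D_v psi x).2).
Proof.
move=> Ux; have dpsi : differentiable psi x by have [+ _] := psi_smooth 1; apply.
by split; split; [exact: is_derive_coord_fst|exact: is_derive_coord_fst|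
  exact: is_derive_coord_snd|exact: is_derive_coord_snd].
Qed.

Hypothesis z_neq0 : forall x, U x -> z x != 0.
Hypothesis z_neqN : forall x, U x -> z x + primary_pos R b != 0.
Hypothesis nrm_neq0 : forall x, U x -> nrm b (z x) (w x) != 0.

Let zc_neq0 x : U x -> (z x)^* != 0.
Proof. by move=> /z_neq0; rewrite conjC_eq0. Qed.

Let zc_neqN x : U x -> (z x)^* + primary_pos R b != 0.
Proof. by move=> /z_neqN; rewrite -conjC_eq0 rmorphD/= primary_pos_conj. Qed.

Lemma smoothc_zeta : smoothc U (fun x => zeta b (z x)).
Proof. by apply: smoothcD; [|exact: smoothc_position|exact: smoothc_cst]. Qed.

Lemma smoothc_alpha : smoothc U (fun x => alpha b (z x) (w x)).
Proof.
have hzc := smoothc_conj oU smoothc_position.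
rewrite /alpha; apply: smoothcM => //.
  apply: smoothcM => //; last exact: smoothc_momentum.
  apply: smoothcM => //; first exact: smoothc_cst.
  by apply: smoothc_eq (smoothcM oU hzc hzc) => // x _; rewrite expr2.
by apply: smoothcV => //; apply: smoothcD => //; exact: smoothc_cst.
Qed.

Lemma smooth_moser_birkhoff : smooth_on U (moser_birkhoff b \o psi).
Proof.
have hz := smoothc_position; have hw := smoothc_momentum.
have hzc := smoothc_conj oU hz.
have ht := smoothc_zeta; have htc := smoothc_conj oU ht.
have ha := smoothc_alpha; have hac := smoothc_conj oU ha.
have hn : smoothc U (fun x => (nrm b (z x) (w x))^-1).
  by apply: smoothcV => //; apply: smoothcD => //; apply: smoothcM.
have sq f : smoothc U f -> smoothc U (fun x => f x ^+ 2).
  by move=> hf; apply: smoothc_eq (smoothcM oU hf hf) => // x _; rewrite expr2.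
have cst c : smoothc U (fun=> c : R[i]) by exact: smoothc_cst.
have hxi : smoothc U (fun x => xi b (z x) (w x)).
  by apply: smoothcM => //; apply: smoothcN => //; apply: smoothcM => //; apply: smoothcM.
have hxi3 : smoothc U (fun x => xi3 b (z x) (w x)).
  by apply: smoothcM => //; apply: smoothcD; rewrite //; [apply: smoothcM|
    apply: smoothcN => //; apply: smoothcM].
have h4 f : (forall x, U x -> f x != 0) -> smoothc U f -> smoothc U (fun x => (4 * f x)^-1).
  move=> f0 hf; apply: smoothcV => [//|x Ux|]; last exact: smoothcM.
  by rewrite mulf_neq0 ?pnatr_eq0 ?f0.
have heta : smoothc U (fun x => eta b (z x) (w x)).
  apply: smoothcD => //; last apply: smoothcN => //.
    by apply: smoothcM => //; [exact: sq|exact: h4].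
  by apply: smoothcM => //; [exact: sq|exact: h4].
have heta3 : smoothc U (fun x => eta3 b (z x) (w x)).
  apply: smoothcM => //; apply: smoothcN => //; apply: smoothcD => //.
    by apply: smoothcM => //; [exact: smoothcM|exact: smoothcV].
  by apply: smoothcM => //; [exact: smoothcM|exact: smoothcV].
have row f g : smoothc U f -> smoothc U g ->
    smooth_on U (fun x => row_of_complex (f x) (g x)).
  move=> [fr fi] [gr gi]; apply: smooth_row => // i.
  case: i => -[|[|[|//]]] hi; move: fr fi gr gi => + + +;
    [move=> h _ _ _|move=> _ h _ _|move=> _ _ h _];
    by apply: smooth_eq h => // x _; rewrite !mxE.
exact: smooth_pair (row _ _ hxi hxi3) (row _ _ heta heta3).
Qed.

(** All components of the image are stationary in direction [v]. Differentiating [J2] to [J5] then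
    forces [z] and [alpha] to be stationary by [tangent_kernel], and [J1], the definition of
    [alpha], does the same for [w]. *)
Lemma moser_birkhoff_immersion x v : U x ->
  'D_v (moser_birkhoff b \o psi) x = 0 -> 'D_v psi x = 0.
Proof.
move=> Ux; set f := _ \o psi => Df0.
have df : differentiable f x by have [+ _] := smooth_moser_birkhoff 1; apply.
have d1 i : is_derive x v (fun y => (f y).1 0 i) 0.
  by have := is_derive_coord_fst v i df; rewrite Df0 mxE.
have d2 i : is_derive x v (fun y => (f y).2 0 i) 0.
  by have := is_derive_coord_snd v i df; rewrite Df0 mxE.
have real (g : V -> R[i]) (r : V -> R) : (forall y, complex.Im (g y) = 0) ->
    (forall y, r y = complex.Re (g y)) -> is_derive x v r 0 -> is_cderive x v g 0.
  move=> gi /funext re h; split; rewrite /= -?re//.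
  by rewrite (_ : (fun y => _) = cst 0); [exact: is_derive_cst|exact/funext].
have cplx (g : V -> R[i]) (r s : V -> R) : (forall y, r y = complex.Re (g y)) ->
    (forall y, s y = complex.Im (g y)) -> is_derive x v r 0 -> is_derive x v s 0 ->
    is_cderive x v g 0.
  by move=> /funext re /funext im h h'; split; rewrite /= -?re -?im.
have dxi : is_cderive x v (fun y => xi b (z y) (w y)) 0.
  by apply: cplx (d1 0) (d1 1) => y; rewrite mxE.
have dxi3 : is_cderive x v (fun y => xi3 b (z y) (w y)) 0.
  by apply: real (d1 2%:R) => y; [exact: xi3_real|rewrite mxE].
have deta : is_cderive x v (fun y => eta b (z y) (w y)) 0.
  by apply: cplx (d2 0) (d2 1) => y; rewrite mxE.
have deta3 : is_cderive x v (fun y => eta3 b (z y) (w y)) 0.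
  by apply: real (d2 2%:R) => y; [exact: eta3_real|rewrite mxE].
have [dz dw] := is_cderive_phase v Ux.
suff [z' w'] : to_complex ('D_v psi x).1 = 0 /\ to_complex ('D_v psi x).2 = 0.
  move: z' w'; case: ('D_v psi x) => p q /= p0 q0.
  rewrite -(to_complexK p) -(to_complexK q) p0 q0.
  by congr pair; apply/matrixP => i j; rewrite !mxE; case: j => -[|[|//]].
move: dz dw; set z' := to_complex _; set w' := to_complex _ => dz dw.
(* The derivative of [alpha] is an unknown whose value is never computed; only the differentiated
   identities constrain it. *)
have [a' da] := smoothc_is_cderive v smoothc_alpha Ux.
have dt : is_cderive x v (fun y => zeta b (z y)) z'.
  apply: is_cderive_eq (is_cderiveD dz (is_cderive_cst x v _)) _; exact: addr0.
have dzc := is_cderive_conj dz; have dtc := is_cderive_conj dt.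
have dac := is_cderive_conj da.
have dn : is_cderive x v (fun y => nrm b (z y) (w y)) _ :=
  is_cderiveD (is_cderiveM dt dtc) (is_cderiveM da dac).
have d2cst c := is_cderive_cst x v (c : R[i]).
have d1xi3 : is_cderive x v (fun y => 1 - xi3 b (z y) (w y)) 0.
  apply: is_cderive_eq (is_cderiveD (d2cst 1) (is_cderiveN dxi3)) _.
  by rewrite oppr0 addr0.
have dQ : is_cderive x v (fun y => (1 - xi3 b (z y) (w y)) * eta b (z y) (w y) +
    eta3 b (z y) (w y) * xi b (z y) (w y)) 0.
  apply: is_cderive_eq (is_cderiveD (is_cderiveM d1xi3 deta) (is_cderiveM deta3 dxi)) _.
  by rewrite !(mulr0, mul0r, addr0).
have J1 y : U y -> alpha b (z y) (w y) * ((z y)^* + primary_pos R b) =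
    2 * ((z y)^* * (z y)^*) * w y.
  by move=> /zc_neqN h; rewrite /alpha expr2 divfK.
have J2 y : U y -> zeta b (z y) * zeta b (z y) =
    2 * z y * ((1 - xi3 b (z y) (w y)) * eta b (z y) (w y) +
    eta3 b (z y) (w y) * xi b (z y) (w y)).
  by move=> Uy; rewrite -expr2; apply: position_from_moser; [exact: z_neq0|exact: nrm_neq0].
have J3 y : U y -> xi b (z y) (w y) * nrm b (z y) (w y) =
    - (2 * alpha b (z y) (w y) * zeta b (z y)).
  by move=> /nrm_neq0 h; rewrite /xi divfK.
have J4 y : U y -> (1 - xi3 b (z y) (w y)) * nrm b (z y) (w y) =
    2 * (zeta b (z y) * (zeta b (z y))^*).
  by move=> /nrm_neq0 h; rewrite /xi3 mulrBl mul1r divfK// /nrm; ring.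
have J5 y : U y -> 4 * (z y * (z y)^*) * eta b (z y) (w y) =
    (z y)^* * (zeta b (z y) * zeta b (z y)) -
    z y * (alpha b (z y) (w y) * alpha b (z y) (w y)).
  by move=> Uy; rewrite /eta; field; rewrite z_neq0 ?zc_neq0.
have E1 := is_cderive_open_unique oU Ux J1
  (is_cderiveM da (is_cderiveD dzc (d2cst (primary_pos R b))))
  (is_cderiveM (is_cderiveM (d2cst 2) (is_cderiveM dzc dzc)) dw).
have E2 := is_cderive_open_unique oU Ux J2 (is_cderiveM dt dt)
  (is_cderiveM (is_cderiveM (d2cst 2) dz) dQ).
have E3 := is_cderive_open_unique oU Ux J3 (is_cderiveM dxi dn)
  (is_cderiveN (is_cderiveM (is_cderiveM (d2cst 2) da) dt)).
have E4 := is_cderive_open_unique oU Ux J4 (is_cderiveM d1xi3 dn)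
  (is_cderiveM (d2cst 2) (is_cderiveM dt dtc)).
have E5 := is_cderive_open_unique oU Ux J5
  (is_cderiveM (is_cderiveM (d2cst 4) (is_cderiveM dz dzc)) deta)
  (is_cderiveD (is_cderiveM dzc (is_cderiveM dt dt))
    (is_cderiveN (is_cderiveM dz (is_cderiveM da da)))).
have {J1}J1 := J1 x Ux; have {J2}J2 := J2 x Ux; have {J3}J3 := J3 x Ux.
have {J4}J4 := J4 x Ux.
have n0 := nrm_neq0 Ux; have z0 := z_neq0 Ux; have zN := z_neqN Ux.
have zc0 := zc_neq0 Ux; have zcN := zc_neqN Ux.
have tE : zeta b (z x) = z x - primary_pos R b by [].
have two0 : (2 : R[i]) != 0 by rewrite pnatr_eq0.
have [z'0 a'0] : z' = 0 /\ a' = 0.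
  move: E2 E3 E4 E5 {E1 J1}; set Q := _ + _ in J2 *.
  set n' := _ + _; rewrite !(mulr0, mul0r, addr0, add0r, subr0).
  move=> E2 E3 E4 E5.
  apply: (tangent_kernel two0 _ _ _ tE z0 zN zc0 n0 J2 J3 J4 _ E3 E4 E5).
  - by rewrite -conjC_eq0.
  - by move=> t0; move: n0; rewrite nrm_eq0 t0 eqxx.
  - by move=> ->; rewrite rmorph0.
  - by rewrite -E2.
split=> //.
(* What remains of [E1] is [2 * (conj z)^2 * w' = 0]. *)
have zc'0 : z'^* = 0 by rewrite z'0 rmorph0.
move: E1; rewrite a'0 zc'0 !(mulr0, mul0r, addr0, add0r) => /esym/eqP.
by rewrite !mulf_eq0 (negPf two0) (negPf zc0) /= => /eqP.
Qed.

End MoserBirkhoffSmooth.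

(** * Collision points *)

(* The fibers of the position projection have dimension 2 < 3. *)
Lemma immersion_position_not_constant (R : realType) (psi : 'rV[R]_3 -> phase R)
    (u : 'rV[R]_3) (c : 'rV[R]_2) :
  differentiable psi u -> injective ('d psi u) -> ~ \near u, (psi u).1 = c.
Proof.
move=> dpsi inj cst.
have D1 v : ('d psi u v).1 = 0.
  apply/matrixP => i j; rewrite ord1 -deriveE// mxE.
  have [_ <-] := is_derive_coord_fst v j dpsi.
  rewrite (@near_eq_derive _ _ _ _ (fun=> c 0 j)) ?derive_cst//.
  by apply: filterS cst => y ->.
pose g v := ('d psi u v).2.
have g_linear : linear g by move=> a v v'; rewrite /g linearP.
pose gM := GRing.isLinear.Build _ _ _ _ _ g_linear.
pose gL : {linear 'rV[R]_3 -> 'rV[R]_2} := HB.pack g gM.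
have [v vM v0] : exists2 v : 'rV[R]_3, v *m lin1_mx gL = 0 & v != 0.
  have /rowV0Pn[v /sub_kermxP vM v0] : kermx (lin1_mx gL) != 0.
    by rewrite -mxrank_eq0 mxrank_ker subn_eq0 -ltnNge (leq_ltn_trans (rank_leq_col _)).
  by exists v.
move: vM v0; rewrite mul_rV_lin1 => gv /eqP; apply; apply: inj.
rewrite [RHS]linear0 [LHS]surjective_pairing D1.
by congr pair.
Qed.

Section Continuity.
Variables (R : realType) (V : normedModType R) (U : set V).

Lemma smoothc_continuous (f : V -> R[i]) x : smoothc U f -> U x ->
  {for x, continuous (fun y => complex.Re (f y))} /\
  {for x, continuous (fun y => complex.Im (f y))}.
Proof. by move=> [fr fi] Ux; split; [exact: (fr 0%N)|exact: (fi 0%N)]. Qed.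

Lemma enorm_of_complex_continuous (f : V -> R[i]) x : smoothc U f -> U x ->
  {for x, continuous (fun y => enorm (of_complex (f y)))}.
Proof.
move=> hf Ux; have [cr ci] := smoothc_continuous hf Ux.
rewrite (_ : (fun y => _) = fun y => Num.sqrt
    (complex.Re (f y) * complex.Re (f y) + complex.Im (f y) * complex.Im (f y))).
  apply: continuous_comp; last exact: sqrt_continuous.
  by apply: cvgD; apply: cvgM.
by apply/funext => y; rewrite /enorm dot2E !mxE.
Qed.

Lemma open_smoothc_neq0 (f : V -> R[i]) : open U -> smoothc U f ->
  open (U `&` [set x | f x != 0]).
Proof.
move=> oU hf; rewrite openE => x [Ux f0].
have [cr ci] := smoothc_continuous hf Ux.
apply: filterI; first exact: open_nbhs_nbhs.
move: f0; rewrite /= eq_complex negb_and => /orP[r0|i0].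
  by apply: filterS (cvgr_neq0 _ cr r0) => y ?; rewrite /= eq_complex negb_and; apply/orP; left.
by apply: filterS (cvgr_neq0 _ ci i0) => y ?; rewrite /= eq_complex negb_and; apply/orP; right.
Qed.

Lemma enorm_of_complex0 : enorm (of_complex (0 : R[i])) = 0.
Proof. by rewrite /enorm dot2E !mxE/= mulr0 addr0 sqrtr0. Qed.

End Continuity.

(** * The regularized Hamiltonian at collisions *)

Section CollisionEnergy.
Variables (R : realType) (mu d : R).
Hypotheses (mu_gt0 : 0 < mu) (mu_lt1 : mu < 1).

(** The factor [r Earth * r Moon] equals [|zeta Earth * zeta Moon|^2 / (4 |z|^2)] and cancels the
    poles of both potentials and of the momentum. Here [p] is that factor times the conjugate
    momentum, so [Im (q * p)] is the rotation term. *)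
Definition regularized_K (x : phase R) : R :=
  let z := to_complex x.1 in let w := to_complex x.2 in
  let r b := enorm (of_complex (zeta b z ^+ 2 / (2 * z))) in
  let p := (zeta Earth z * zeta Moon z)^* * z * w^* / (2 * z^*) in
  let q := (z ^+ 2 + 4^-1) / (2 * z) + (2^-1 - mu)%:C in
  2^-1 * complex.Re (z * z^* * (w * w^*)) + complex.Im (q * p)
  - mu * r Moon - (1 - mu) * r Earth - d * (r Earth * r Moon).

Lemma enorm_of_complexE (c : R[i]) : (enorm (of_complex c))%:C = `|c|.
Proof. by rewrite normc_def /enorm dot2E !mxE/= -!expr2. Qed.

Lemma K_rawE x : birkhoff_domain x -> K_raw mu d x = regularized_K x.
Proof.
move=> dx; have /birkhoff_domainP[z0 zb] := dx.
pose z := to_complex x.1; pose w := to_complex x.2.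
pose r b := enorm (of_complex (zeta b z ^+ 2 / (2 * z))).
have rE b : enorm ((birkhoff x).1 - shifted_pos R b) = r b.
  by rewrite /r -(birkhoff_pos mu b z0) pos_shifted /unshift/= opprD addrA addrK.
have rE' b : enorm ((unshift mu (birkhoff x)).1 - pos mu b) = r b.
  by rewrite birkhoff_pos.
have r0 b : r b != 0.
  rewrite -(inj_eq (@complexI R)) /r enorm_of_complexE normr_eq0.
  by rewrite mulf_neq0 ?sqrf_eq0 ?zeta_neq0 ?zb// invr_eq0 mulf_neq0 ?pnatr_eq0.
pose pc := alpha Earth z w / (zeta Earth z)^*.
pose qc := (z ^+ 2 + 4^-1) / (2 * z) + (2^-1 - mu)%:C.
have pE : (unshift mu (birkhoff x)).2 = of_complex pc by rewrite -birkhoff_mom.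
have qE : (unshift mu (birkhoff x)).1 = of_complex qc.
  have ofD (c c' : R[i]) : of_complex (c + c') = of_complex c + of_complex c'.
    apply/matrixP => i j; rewrite !mxE; case: c c' => ? ? [? ?].
    by case: j => -[|[|//]].
  by rewrite ofD.
have rho : (r Earth * r Moon)%:C = (zeta Earth z * zeta Moon z / (2 * z)) *
    (zeta Earth z * zeta Moon z / (2 * z))^*.
  by rewrite rmorphM /r /= !enorm_of_complexE -normCK -normrM -normrX; congr `|_|; field.
have tE0 : (zeta Earth z)^* != 0 by rewrite conjC_eq0 zeta_neq0.
have tM0 : (zeta Moon z)^* != 0 by rewrite conjC_eq0 zeta_neq0.
have tMN : z^* + primary_pos R Earth = (zeta Moon z)^*.
  rewrite rmorphB/= primary_pos_conj; congr (_ + _).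
  by rewrite /primary_pos -rmorphN opprK.
have Re_rho c : r Earth * r Moon * complex.Re c = complex.Re ((r Earth * r Moon)%:C * c).
  by case: c => ? ?; rewrite /= mul0r subr0.
have Im_rho c : r Earth * r Moon * complex.Im c = complex.Im ((r Earth * r Moon)%:C * c).
  by case: c => ? ?; rewrite /= mul0r addr0.
have zc0 : z^* != 0 by rewrite conjC_eq0.
have pcE : pc^* = 2 * z ^+ 2 * w^* / (zeta Moon z * zeta Earth z).
  rewrite /pc /alpha tMN !rmorphM !fmorphV/= !conjCK rmorph_nat.
  by rewrite invfM !mulrA.
have pcE' : pc = 2 * z^* ^+ 2 * w / ((zeta Moon z)^* * (zeta Earth z)^*).
  by rewrite /pc /alpha tMN invfM !mulrA.
have rhoE : (r Earth * r Moon)%:C = zeta Earth z * zeta Moon z *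
    ((zeta Earth z)^* * (zeta Moon z)^*) / (4 * (z * z^*)).
  rewrite rho !rmorphM fmorphV/= rmorphM/= rmorph_nat.
  by field; rewrite zc0 z0.
have tE := zeta_neq0 (zb Earth); have tM := zeta_neq0 (zb Moon).
have kin : complex.Re (z * z^* * (w * w^*)) = r Earth * r Moon * complex.Re (pc * pc^*).
  rewrite Re_rho rhoE pcE pcE'; congr complex.Re.
  by field; rewrite tE0 tM0 zc0 z0 tE tM.
have ang : complex.Im (qc * ((zeta Earth z * zeta Moon z)^* * z * w^* / (2 * z^*))) =
    r Earth * r Moon * complex.Im (qc * pc^*).
  rewrite Im_rho rhoE pcE rmorphM; congr complex.Im.
  by move: qc {qE} => qc; field; rewrite zc0 z0 tE tM.
have HE (p q : R[i]) : 2^-1 * enorm (of_complex p) ^+ 2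
    + of_complex p 0 0 * of_complex q 0 1 - of_complex p 0 1 * of_complex q 0 0
    = 2^-1 * complex.Re (p * p^*) + complex.Im (q * p^*).
  by rewrite enorm2_sqr !mxE; case: p q => ? ? [? ?] /=; ring.
rewrite /K_raw /H_shifted /H !rE !rE' pE qE HE /regularized_K.
rewrite -/z -/w -/(r Earth) -/(r Moon) -/qc kin ang.
by field; rewrite !r0.
Qed.

(** Continuity across the collision fibers evaluates the limit that defines [K] there. The distances
    are handled as square roots, the other terms as smooth functions. *)
Lemma regularized_K_continuous (x : phase R) : to_complex x.1 != 0 ->
  {for x, continuous regularized_K}.
Proof.
move=> z0; pose z (y : phase R) := to_complex y.1; pose w (y : phase R) := to_complex y.2.
have sm_id : smooth_on [set: phase R] id := smooth_id openT.
have hzT : smoothc [set: phase R] z by apply: smoothc_position => //; exact: openT.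
have hwT : smoothc [set: phase R] w by apply: smoothc_momentum => //; exact: openT.
pose U := setT `&` [set y | z y != 0].
have oU : open U by apply: open_smoothc_neq0 => //; exact: openT.
have Ux : U x by [].
have hz : smoothc U z := smoothc_sub (@subIsetl _ _ _) hzT.
have hw : smoothc U w := smoothc_sub (@subIsetl _ _ _) hwT.
have cst c : smoothc U (fun=> c : R[i]) by exact: smoothc_cst.
have hzc := smoothc_conj oU hz; have hwc := smoothc_conj oU hw.
have sq f : smoothc U f -> smoothc U (fun y => f y ^+ 2).
  by move=> hf; apply: smoothc_eq (smoothcM oU hf hf) => // y _; rewrite expr2.
have h2 f : (forall y, U y -> f y != 0) -> smoothc U f -> smoothc U (fun y => (2 * f y)^-1).
  move=> f0 hf; apply: smoothcV => [//|y Uy|]; last exact: smoothcM.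
  by rewrite mulf_neq0 ?pnatr_eq0 ?f0.
have h2z : smoothc U (fun y => (2 * z y)^-1) by apply: h2 => // y [].
have h2zc : smoothc U (fun y => (2 * (z y)^*)^-1).
  by apply: h2 => // y [_]; rewrite /= conjC_eq0.
have ht b : smoothc U (fun y => zeta b (z y)) by apply: smoothcD.
have hr b : {for x, continuous (fun y => enorm (of_complex (zeta b (z y) ^+ 2 / (2 * z y))))}.
  apply: enorm_of_complex_continuous Ux; apply: smoothcM => //; exact: sq.
have hK : smoothc U (fun y => z y * (z y)^* * (w y * (w y)^*)).
  by do 2?apply: smoothcM => //; apply: smoothcM.
have hA : smoothc U (fun y => ((z y ^+ 2 + 4^-1) / (2 * z y) + (2^-1 - mu)%:C) *
   ((zeta Earth (z y) * zeta Moon (z y))^* * z y * (w y)^* / (2 * (z y)^*))).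
  apply: smoothcM => //.
    apply: smoothcD => //; apply: smoothcM => //; apply: smoothcD => //; exact: sq.
  apply: smoothcM => //; apply: smoothcM => //; apply: smoothcM => //.
  by apply: smoothc_conj => //; exact: smoothcM.
have [cK _] := smoothc_continuous hK Ux.
have [_ cA] := smoothc_continuous hA Ux.
rewrite /regularized_K /=; apply: cvgB.
  apply: cvgB; last by apply: cvgM; [exact: cvg_cst|exact: hr].
  apply: cvgB; last by apply: cvgM; [exact: cvg_cst|exact: hr].
  by apply: cvgD; [apply: cvgM; [exact: cvg_cst|exact: cK]|exact: cA].
by apply: cvgM; [exact: cvg_cst|apply: cvgM; exact: hr].
Qed.

(* The collision circles of K^{-1}(0) thus avoid alpha = 0, the only singularity
   of the extended Moser map.  Without the closure hypothesis the limit defining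
   K would be taken along an improper filter. *)
Lemma K_neq0 b (x : phase R) : closure (@birkhoff_domain R) x ->
  to_complex x.1 = primary_pos R b -> to_complex x.2 = 0 -> K mu d x != 0.
Proof.
move=> clx zb w0; have z0 : to_complex x.1 != 0 by rewrite zb primary_pos_neq0.
have pf := @within_nbhs_proper _ (@birkhoff_domain R) x clx.
have -> : K mu d x = regularized_K x.
  apply: cvg_lim => //.
  apply: (@cvg_trans _ (regularized_K y @[y --> within (@birkhoff_domain R) (nbhs x)])).
    apply: near_eq_cvg; rewrite near_withinE; apply: nearW => y dy.
    by rewrite K_rawE.
  exact: cvg_within_filter (regularized_K_continuous z0).
rewrite /regularized_K w0 zb conjC0 !(mulr0, mul0r).
rewrite -[complex.Im 0]/(0 : R).
have t0 : zeta b (primary_pos R b) = 0 by rewrite /zeta subrr.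
have r0 b' : b' <> b ->
    enorm (of_complex (zeta b' (primary_pos R b) ^+ 2 / (2 * primary_pos R b))) != 0.
  move=> bb'; rewrite -(inj_eq (@complexI R)) enorm_of_complexE normr_eq0.
  have e0 := primary_pos_neq0 R b.
  apply: mulf_neq0; last by rewrite invr_eq0 mulf_neq0 ?pnatr_eq0.
  rewrite sqrf_eq0 /zeta.
  have -> : primary_pos R b' = - primary_pos R b.
    by case: b b' {t0 zb e0} bb' => -[]//= _; rewrite /primary_pos -rmorphN ?opprK.
  by rewrite opprK -mulr2n mulrn_eq0 (negPf e0).
have rb : enorm (of_complex (zeta b (primary_pos R b) ^+ 2 / (2 * primary_pos R b))) = 0.
  by rewrite t0 expr0n mul0r enorm_of_complex0.
(* Only [- mu * r Moon] survives at the Earth and [- (1 - mu) * r Earth] at the Moon: the mass of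
   the primary that is hit times the distance to the other. *)
move: r0 rb {zb t0}; case: b => r0 ->; rewrite !(mulr0, mul0r, subr0, addr0) add0r.
  by rewrite oppr_eq0 mulf_neq0 ?r0 ?gt_eqF.
by rewrite oppr_eq0 mulf_neq0 ?r0 ?gt_eqF// subr_gt0.
Qed.

End CollisionEnergy.

(** * Lifting parametrizations to the Moser space *)

Section LiftToMoser.
Variables (R : realType) (mu d : R).
Hypotheses (mu_gt0 : 0 < mu) (mu_lt1 : mu < 1).

(** Meaningful only at collision points; everything not over the Earth gets [Moon] as a default. *)
Definition nearest_primary (x : phase R) : primary :=
  if to_complex x.1 == primary_pos R Earth then Earth else Moon.

Definition lift_to_moser (x : phase R) : moser_point R :=
  if x \in @birkhoff_domain R then Regular (unshift mu (birkhoff x))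
  else Collision (nearest_primary x) (moser_birkhoff (nearest_primary x) x).

Lemma moser_proj_lift x : moser_proj (lift_to_moser x) = birkhoff_proj mu x.
Proof. by rewrite /lift_to_moser /birkhoff_proj; case: ifP. Qed.

Lemma SigmaB_neq0 x : SigmaB mu d x -> to_complex x.1 != 0.
Proof.
move=> [[x0 _] _]; apply/eqP => h; apply: x0.
rewrite -(to_complexK x.1) h; apply/matrixP => i j; rewrite !mxE.
by case: j => -[|[|//]].
Qed.

Lemma SigmaB_Sigma x : SigmaB mu d x -> birkhoff_domain x ->
  Sigma mu d (unshift mu (birkhoff x)).
Proof.
by move=> [Kx [_ sub]] dx; apply: sub; exists x => //; split=> //; exact: connected_component_refl.
Qed.

Lemma collision_primary b x : to_complex x.1 != 0 ->
  to_complex x.1 + primary_pos R b != 0 -> ~ birkhoff_domain x ->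
  to_complex x.1 = primary_pos R b.
Proof.
move=> z0 zN nd; apply: contrapT => /eqP zb; apply: nd; apply/birkhoff_domainP.
split=> // b'; have [->//|bb'] := pselect (b' = b).
rewrite -subr_eq0; have <- // : primary_pos R b = - primary_pos R b'.
by case: b b' {zN zb} bb' => -[]//= _; rewrite /primary_pos -rmorphN ?opprK.
Qed.

Lemma nearest_primaryE b x : to_complex x.1 = primary_pos R b -> nearest_primary x = b.
Proof.
rewrite /nearest_primary => ->; case: b; rewrite ?eqxx//.
by rewrite /primary_pos (inj_eq (@complexI R)) eqNr invr_eq0 pnatr_eq0.
Qed.

Section LiftedPiece.
Variables (V : set 'rV[R]_3) (psi : 'rV[R]_3 -> phase R) (b : primary).
Hypotheses (oV : open V) (psiV : psi @` V `<=` SigmaB mu d).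
Hypothesis psi_smooth : smooth_on V psi.
Hypothesis psi_imm : forall y, V y -> injective ('d psi y).
Hypothesis V_far : forall y, V y -> to_complex (psi y).1 + primary_pos R b != 0.

Let z_neq0 y : V y -> to_complex (psi y).1 != 0.
Proof. by move=> Vy; apply: SigmaB_neq0; apply: psiV; exists y. Qed.

Let psi_diff y : V y -> differentiable psi y.
Proof. by have [+ _] := psi_smooth 1; apply. Qed.

(** Otherwise the position would be frozen at the primary [b] near [y], which an immersion of R^3
    excludes. *)
Let domain_dense y : V y -> forall B, nbhs y B ->
  exists y', [/\ B y', V y' & birkhoff_domain (psi y')].
Proof.
move=> Vy B nB; apply: contrapT => no.
apply: (@immersion_position_not_constant R psi y (of_complex (primary_pos R b))
  (psi_diff Vy) (psi_imm Vy)).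
apply: filterS2 nB (open_nbhs_nbhs (conj oV Vy)) => y' By' Vy'.
apply: (can_inj (@to_complexK R)); rewrite of_complexK.
apply: collision_primary; [exact: z_neq0|exact: V_far|].
by move=> dy'; apply: no; exists y'.
Qed.

(** [K] vanishes on the hypersurface but not at a collision with [w = 0]; density provides the
    closure hypothesis of [K_neq0]. *)
Let w_neq0 y : V y -> ~ birkhoff_domain (psi y) -> to_complex (psi y).2 != 0.
Proof.
move=> Vy nd; have zb := collision_primary (z_neq0 Vy) (V_far Vy) nd.
apply/eqP => w0; have [[_ K0] _] : SigmaB mu d (psi y) by apply: psiV; exists y.
move/eqP: K0; apply/negP; apply: (K_neq0 d mu_gt0 mu_lt1 _ zb w0).
move=> B nB; have [y' [By' _ dy']] := domain_dense Vy (differentiable_continuous (psi_diff Vy) nB).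
by exists (psi y').
Qed.

Let nrm_neq0 y : V y -> nrm b (to_complex (psi y).1) (to_complex (psi y).2) != 0.
Proof.
move=> Vy; rewrite nrm_eq0 negb_and.
have [dy|nd] := pselect (birkhoff_domain (psi y)).
  by have /birkhoff_domainP[_ zb] := dy; rewrite zeta_neq0.
apply/orP; right; rewrite /alpha mulf_neq0 ?invr_eq0//.
  by rewrite !mulf_neq0 ?pnatr_eq0 ?conjC_eq0 ?w_neq0 ?z_neq0.
by have := V_far Vy; rewrite -conjC_eq0 rmorphD/= primary_pos_conj.
Qed.

(** In the chart of [b] a single formula covers both branches of the lift; this is what makes it
    smooth across the collision fiber. *)
Lemma lift_chart y : V y ->
  moser_chart mu b (lift_to_moser (psi y)) = moser_birkhoff b (psi y).
Proof.
move=> Vy; rewrite /lift_to_moser; case: ifPn => [/set_mem dy|/negP nd] /=.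
  exact: moser_birkhoffE.
have zb := collision_primary (z_neq0 Vy) (V_far Vy) (fun h => nd (mem_set h)).
by rewrite (nearest_primaryE zb).
Qed.

Lemma lift_dom : (lift_to_moser \o psi) @` V `<=` moser_dom mu d b.
Proof.
move=> _ [y Vy <-] /=; have Sy : SigmaB mu d (psi y) by apply: psiV; exists y.
rewrite /lift_to_moser; case: ifPn => [/set_mem dy|/negP nd]; first exact: SigmaB_Sigma.
have zb := collision_primary (z_neq0 Vy) (V_far Vy) (fun h => nd (mem_set h)).
rewrite (nearest_primaryE zb); split=> //.
have t0 : zeta b (to_complex (psi y).1) = 0 by rewrite /zeta zb subrr.
have n0 := nrm_neq0 Vy.
(* The base point is the north pole because [zeta = 0] gives [xi = 0] and [xi3 = 1]. For the
   closure, nearby regular parameters are mapped close by continuity. *)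
split; last first.
  rewrite /moser_birkhoff [(_, _).1]/= /xi /xi3 t0 mulr0 oppr0 !mul0r subr0.
  move: n0; rewrite /nrm t0 mul0r add0r => n0.
  by rewrite divff.
move=> B nB.
have cf : {for y, continuous (moser_birkhoff b \o psi)}.
  exact: (smooth_moser_birkhoff oV psi_smooth z_neq0 V_far nrm_neq0 0%N).
(* [q] is the position relative to [b]. It vanishes at the collision, so nearby points satisfy the
   radius bound in [Sigma_near]. *)
pose q y' := zeta b (to_complex (psi y').1) ^+ 2 / (2 * to_complex (psi y').1).
have hz := smoothc_position oV psi_smooth.
have hq : smoothc V q.
  have ht : smoothc V (fun y => zeta b (to_complex (psi y).1)).
    by apply: smoothcD => //; exact: smoothc_cst.
  apply: smoothcM => //.
    by apply: smoothc_eq (smoothcM oV ht ht) => // y' _; rewrite expr2.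
  apply: smoothcV => // [y' Vy'|]; first by rewrite mulf_neq0 ?pnatr_eq0 ?z_neq0.
  by apply: smoothcM => //; exact: smoothc_cst.
have cq := enorm_of_complex_continuous hq Vy.
have near_q : \near y, enorm (of_complex (q y)) < 2^-1.
  apply: cvgr_lt cq _ _.
  by rewrite /q t0 expr0n mul0r enorm_of_complex0 invr_gt0.
have near_B : \near y, B ((moser_birkhoff b \o psi) y) by exact: cf.
have [y' [[By' qy'] Vy' dy']] := domain_dense Vy (filterI near_B near_q).
exists (moser_birkhoff b (psi y')); split=> //.
exists (unshift mu (birkhoff (psi y'))); last exact: moser_birkhoffE.
split; first by apply: SigmaB_Sigma => //; apply: psiV; exists y'.
by rewrite birkhoff_pos ?z_neq0.
Qed.

Lemma lift_smooth : smooth_on V (moser_chart mu b \o (lift_to_moser \o psi)).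
Proof.
apply: smooth_eq (smooth_moser_birkhoff oV psi_smooth z_neq0 V_far nrm_neq0) => //.
by move=> y Vy; rewrite /= lift_chart.
Qed.

Lemma lift_immersion y : V y ->
  injective ('d (moser_chart mu b \o (lift_to_moser \o psi)) y).
Proof.
move=> Vy v1 v2 e; apply: (psi_imm Vy).
have dg : differentiable (moser_chart mu b \o (lift_to_moser \o psi)) y.
  by have [+ _] := lift_smooth 1; apply.
apply/eqP; rewrite -subr_eq0 -linearB/= -(deriveE _ (psi_diff Vy)); apply/eqP.
apply: (moser_birkhoff_immersion oV psi_smooth z_neq0 V_far nrm_neq0 Vy).
transitivity ('D_(v1 - v2) (moser_chart mu b \o (lift_to_moser \o psi)) y).
  by apply: near_eq_derive; apply: open_near_eq Vy => // y' Vy'; rewrite /= lift_chart.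
by rewrite (deriveE _ dg) linearB/= e subrr.
Qed.

End LiftedPiece.

(** Around each point a primary [b] is picked whose antipode [- primary_pos b] is not the position
    there, and the piece is shrunk to keep [alpha b] away from its pole. *)
Lemma lift_parametrization U psi :
  parametrization (X := birkhoff_space mu d) U psi ->
  parametrization (X := moser_space mu d) U (lift_to_moser \o psi).
Proof.
move=> [oU loc]; split=> // u Uu.
have [[] [V [oV Vu VU psiV [psi_sm psi_imm]]]] := loc u Uu.
have z0 : to_complex (psi u).1 != 0 by apply: SigmaB_neq0; apply: psiV; exists u.
(* If [Moon] fails, then [z = primary_pos Earth], and for [Earth] the sum is [2 * z <> 0]. *)
have [b zN] : exists b, to_complex (psi u).1 + primary_pos R b != 0.
  have [zM|zM] := eqVneq (to_complex (psi u).1 + primary_pos R Moon) 0; last by exists Moon.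
  exists Earth; have -> : primary_pos R Earth = to_complex (psi u).1.
    apply/eqP; rewrite eq_sym -subr_eq0 -[X in _ == X]zM /primary_pos.
    by rewrite -rmorphN.
  by rewrite -mulr2n mulrn_eq0 (negPf z0).
pose V' := V `&` [set y | to_complex (psi y).1 + primary_pos R b != 0].
have V'V : V' `<=` V by exact: subIsetl.
have oV' : open V'.
  apply: open_smoothc_neq0 => //; apply: smoothcD => //; last exact: smoothc_cst.
  exact: smoothc_position.
have psi_sm' : smooth_on V' psi by move=> k; exact: Ck_sub V'V (psi_sm k).
have psiV' : psi @` V' `<=` SigmaB mu d.
  by move=> _ [y /V'V Vy <-]; apply: psiV; exists y.
have psi_imm' y : V' y -> injective ('d psi y) by move=> /V'V; exact: psi_imm.
have far y : V' y -> to_complex (psi y).1 + primary_pos R b != 0 by case.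
exists b, V'; split=> //.
- by move=> y /V'V /VU.
- exact: lift_dom.
split; first exact: lift_smooth.
by move=> y V'y; exact: (lift_immersion oV' psiV' psi_sm' psi_imm' far V'y).
Qed.

End LiftToMoser.

Theorem proposition2p4 (R : realType) (mu : R) (mu_gt0 : 0 < mu) (mu_lt1 : mu < 1)
    (L : 'I_5 -> phase R) (HL : lagrange_points mu L)
    (eps : R) (eps_gt0 : 0 < eps)
    (eps_le : H mu (L 0) + eps <= H mu (L 1))
    (moser_contact : forall d : R,
       H mu (L 0) < d -> d < H mu (L 0) + eps -> moser_admits_contact_form mu d) :
  forall d : R, H mu (L 0) < d -> d < H mu (L 0) + eps ->
    birkhoff_admits_contact_form mu d.
Proof.
move=> d d1 d2; have [w [[[w_smooth w_coord] w_contact] w_reeb]] := moser_contact d d1 d2.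
have lift U psi := @lift_parametrization R mu d mu_gt0 mu_lt1 U psi.
(* Both forms have the same coordinate expressions, so smoothness, the transformation rule and the
   contact condition transfer verbatim. *)
exists (fun psi => w (lift_to_moser mu \o psi)); split.
  split; [split|].
  - by move=> U psi /lift; exact: w_smooth.
  - move=> U V psi phi h /lift hpsi /lift hphi hh sub e u v Uu.
    by apply: w_coord hpsi hphi hh sub _ _ _ Uu => y Uy /=; rewrite e.
  - by move=> U psi u /lift; exact: w_contact.
move=> I g oI itvI tr g_reg.
have [||tau [c [h1 h2 h3]]] := w_reeb I (lift_to_moser mu \o g) oI itvI.
(* The curve [c] in R^3 and its Reeb vector are unchanged; only the parametrization is composed with
   the lift. *)
- move=> t It; have [U [psi [c [hpsi near_c [r hr hc]]]]] := tr t It.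
  exists U, (lift_to_moser mu \o psi), c; split; [exact: lift| |by exists r].
  by apply: filterS near_c => s [Us gs]; split=> //=; rewrite gs.
- by move=> t It; rewrite /= moser_proj_lift; exact: g_reg.
by exists tau, c; split=> // t It; rewrite -moser_proj_lift; exact: h3.
Qed.
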